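(* Let $\rho>0$, let $A\colon[0,\infty)\to\mathbb R^{n\times n}$ and $f\colon[0,\infty)\times\mathbb R^n\to\mathbb R^n$ be continuous, and suppose that $x'=A(t)x$ has an exponential dichotomy on $[0,\infty)$ with constants $N,\lambda>0$. Suppose there exists $L>0$ such that $|f(t,x)|\le L|x|$ for all $t\ge0$ and $x\in B_\rho(0)$, and that $L<\lambda/(2N)$. Then there exists $\varepsilon>0$ such that if $y$ is a pseudosolution of $x'=A(t)x+f(t,x)$ on $[0,\tau)$ for some $\tau\in(0,\infty]$ with $\sigma_y\le\varepsilon$, then this equation has a pseudosolution $z$ on $[0,\tau)$ with $z(t)\in B_\rho(0)$ for all $t\in[0,\tau)$ and $e_z(t)=e_y(t)$ for all $t\in[0,\tau)$.
   Context: $|\cdot|$ is a fixed norm on $\mathbb R^n$ and the induced matrix norm; $B_r(x)=\{y:|y-x|\le r\}$. For continuous $g\colon[0,\infty)\times\mathbb R^n\to\mathbb R^n$ and $\tau\in(0,\infty]$, a pseudosolution of $x'=g(t,x)$ on $[0,\tau)$ is a $C^1$ map $y\colon[0,\tau)\to\mathbb R^n$ with $\sigma_y:=\sup_{0\le t<\tau}|y'(t)-g(t,y(t))|<\infty$; its error function is $e_y(t):=|y'(t)-g(t,y(t))|$, $t\in[0,\tau)$. Here $g(t,x)=A(t)x+f(t,x)$. With $T(t,s)$ the transition matrix of $x'=A(t)x$: an exponential dichotomy on $[0,\infty)$ consists of projections $P(t)$ and constants $N,\lambda>0$ with $P(t)T(t,s)=T(t,s)P(s)$ for all $t,s\ge0$,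 $|T(t,s)P(s)|\le Ne^{-\lambda(t-s)}$ for $t\ge s\ge0$, and $|T(t,s)(I-P(s))|\le Ne^{-\lambda(s-t)}$ for $0\le t\le s$. *)

(* Defs.v *)
From HB Require Import structures.
From mathcomp Require Import all_boot all_order all_algebra.
From mathcomp Require Import all_classical all_reals all_analysis.
Set Implicit Arguments. Unset Strict Implicit. Unset Printing Implicit Defensive.
Import Order.TTheory GRing.Theory Num.Theory.
Import numFieldNormedType.Exports.
Local Open Scope classical_set_scope.
Local Open Scope ring_scope.

Definition is_norm (R : realType) (n : nat) (nu : 'cV[R]_n -> R) : Prop :=
  [/\ (forall x, 0 <= nu x),
      (forall x, nu x = 0 -> x = 0),
      (forall (a : R) x, nu (a *: x) = `|a| * nu x) &
      (forall x y, nu (x + y) <= nu x + nu y)].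

Definition mxnorm_le (R : realType) (n : nat) (nu : 'cV[R]_n -> R)
  (M : 'M[R]_n) (c : R) : Prop :=
  forall v : 'cV[R]_n, nu (M *m v) <= c * nu v.

(* dy is the derivative of y relative to the set D (one-sided at endpoints). *)
Definition has_deriv_on (R : realType) (V : normedModType R) (D : set R)
  (y : R -> V) (dy : R -> V) : Prop :=
  forall t, D t ->
    (fun h : R => h^-1 *: (y (t + h) - y t)) @ within [set h | D (t + h)] (0 : R)^'
      --> dy t.

Definition transition_matrix (R : realType) (n : nat)
  (A : R -> 'M[R]_n) (T : R -> R -> 'M[R]_n) : Prop :=
  forall s, 0 <= s ->
    T s s = 1%:M /\
    has_deriv_on [set t | 0 <= t] (fun t => T t s) (fun t => A t *m T t s).

Definition exp_dichotomy (R : realType) (n : nat) (nu : 'cV[R]_n -> R)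
  (T : R -> R -> 'M[R]_n) (N lam : R) : Prop :=
  exists P : R -> 'M[R]_n,
    (forall t, 0 <= t -> P t *m P t = P t) /\
    (forall t s, 0 <= t -> 0 <= s -> P t *m T t s = T t s *m P s) /\
    (forall t s, 0 <= s -> s <= t ->
        mxnorm_le nu (T t s *m P s) (N * expR (- lam * (t - s)))) /\
    (forall t s, 0 <= t -> t <= s ->
        mxnorm_le nu (T t s *m (1%:M - P s)) (N * expR (- lam * (s - t)))).

Definition dom0 (R : realType) (tau : \bar R) : set R :=
  [set t | 0 <= t /\ (t%:E < tau)%E].

Definition pseudosolution (R : realType) (n : nat) (nu : 'cV[R]_n -> R)
  (g : R -> 'cV[R]_n -> 'cV[R]_n) (tau : \bar R) (y dy : R -> 'cV[R]_n) : Prop :=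
  [/\ has_deriv_on (dom0 tau) y dy,
      {within dom0 tau, continuous dy} &
      exists M : R, forall t, dom0 tau t -> nu (dy t - g t (y t)) <= M].

Definition err (R : realType) (n : nat) (nu : 'cV[R]_n -> R)
  (g : R -> 'cV[R]_n -> 'cV[R]_n) (y dy : R -> 'cV[R]_n) (t : R) : R :=
  nu (dy t - g t (y t)).

(* Main.v *)
(** Put [h t := dy t - g t (y t)]: it suffices to find a solution [z] of
    [z' = A z + f(t, r z) + h] with values in the ball of radius [rho], where
    [r] is the radial retraction onto that ball, so that the nonlinearity is
    bounded by [B := L rho + eps].  On the grid of mesh [d] the Green function
    of the dichotomy turns this into the finite-dimensional fixed point problem
    [Z_i = sum_j d G(t_i, t_j) (f(t_j, r Z_j) + h(t_j))], which Brouwer's theorem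
    solves since the right-hand side is bounded by about [2 N B / lam = rho].
    As a function of [t] the same sum solves the linear equation between the
    nodes and jumps by [d (f + h)] at them, so a mean value inequality controls its
    increments, and a limit along an ultrafilter of meshes tending to [0] is a
    solution.

    Brouwer's theorem comes from a Sperner lemma on the discrete torus, where
    there is no boundary and two fixed-point-free involutions show that every
    labelling has an even number of full simplices; those crossing the
    zero coordinate are the same for any labelling with standard boundary values,
    and the standard labelling has exactly one further full simplex. *)

Require Import Defs.
From HB Require Import structures.
From mathcomp Require Import all_boot all_order all_algebra.
From mathcomp Require Import fingroup perm.
From mathcomp Require Import all_classical all_reals all_analysis.
From mathcomp Require Import ring lra zify.
Set Implicit Arguments. Unset Strict Implicit. Unset Printing Implicit Defensive.
Import Order.TTheory GRing.Theory Num.Theory.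
Import numFieldNormedType.Exports.
Local Open Scope ring_scope.

(** * A Sperner lemma on the discrete torus *)

Lemma even_card_involution (T : finType) (A : {set T}) (f : T -> T) :
  {in A, forall x, [/\ f x \in A, f (f x) = x & f x != x]} -> ~~ odd #|A|.
Proof.
have [k] := ubnP #|A|; elim: k A => // k IH A; rewrite ltnS => Ak fP.
have [->|/set0Pn[x xA]] := eqVneq A finset.set0; first by rewrite cards0.
have [fxA ffx fxx] := fP _ xA.
have xB : f x \in A :\ x by rewrite !inE fxx.
rewrite (cardsD1 x) xA (cardsD1 (f x)) xB !add1n /= negbK.
apply: IH; first by move: Ak; rewrite (cardsD1 x) xA (cardsD1 (f x)) xB; lia.
move=> y; rewrite !inE => /and3P[yfx yx yA]; have [fyA ffy fyy] := fP _ yA.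
split => //; rewrite fyA andbT; apply/andP; split.
  by apply: contra yx => /eqP e; rewrite -ffy e ffx.
by apply: contra yfx => /eqP e; rewrite -ffy e.
Qed.

Section TorusSperner.
Variables (n m : nat).
Implicit Types (i j k : 'I_n.+2).
Local Notation V := {ffun 'I_n.+1 -> 'I_m.+2}.
Local Notation flagT := ({ffun 'I_n.+2 -> V} * 'S_n.+2)%type.
Implicit Types (a : flagT) (l : V -> 'I_n.+2).

Definition torus_step i : V :=
  [ffun c : 'I_n.+1 => (i == c :> nat)%:R - (i == n.+1 :> nat)%:R].

(* A flag is a simplex of the Kuhn triangulation of the torus with a marked
   vertex [a.1 0]: its vertices form a cycle whose edges are the basis vectors
   and the vector [-(1, ..., 1)], each used once, in the order given by [a.2]. *)
Definition is_flag a :=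
  [forall i, a.1 (i + 1) == a.1 i + torus_step (a.2 i)].

Definition full l a :=
  [&& is_flag a, l (a.1 0) == 0 & injectiveb (fun i => l (a.1 i))].

(* A full flag is a door whose marked vertex has label [0]; [flip] pairs all doors, and
   turning to the twin vertex pairs the others. *)
Definition door l a :=
  [&& is_flag a, [forall i, (i != 0) ==> (l (a.1 i) != 0)] &
      [forall i, forall j,
         [&& i != 0, j != 0 & l (a.1 i) == l (a.1 j)] ==> (i == j)]].

Lemma flagP a : reflect (forall i, a.1 (i + 1) = a.1 i + torus_step (a.2 i))
  (is_flag a).
Proof. by apply: (iffP forallP) => H i; apply/eqP; apply: H. Qed.

Lemma fullP l a : reflect [/\ is_flag a, l (a.1 0) = 0 &
  injective (fun i => l (a.1 i))] (full l a).
Proof.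
by apply: (iffP and3P) => -[? /eqP ? /injectiveP ?]; split=> //; apply/eqP.
Qed.

Lemma doorP l a : reflect [/\ is_flag a, (forall i, i != 0 -> l (a.1 i) != 0) &
  (forall i j, i != 0 -> j != 0 -> l (a.1 i) = l (a.1 j) -> i = j)] (door l a).
Proof.
apply: (iffP and3P) => -[fa H1 H2]; split => //.
- by move=> i; apply/implyP; move/forallP: H1.
- move=> i j i0 j0 e; move/forallP/(_ i)/forallP/(_ j): H2.
  by rewrite i0 j0 e eqxx => /eqP.
- by apply/forallP => i; apply/implyP/H1.
- apply/forallP => i; apply/forallP => j; apply/implyP => /and3P[i0 j0 /eqP e].
  exact/eqP/H2.
Qed.

(* Replaces the marked vertex by the one across the opposite face. *)
Definition flip a : flagT :=
  ([ffun i => if i == 0 then a.1 (-1) + torus_step (a.2 0) else a.1 i],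
   (tperm 0 (-1) * a.2)%g).

(** The same cycle of vertices, with the mark moved [k] places along it. *)
Definition turn k a : flagT :=
  ([ffun i => a.1 (i + k)], (perm (addIr k) * a.2)%g).

Let oner_neq0I : (1 : 'I_n.+2) != 0. Proof. exact: oner_neq0. Qed.
Let opp1_neq0I : (-1 : 'I_n.+2) != 0. Proof. by rewrite oppr_eq0. Qed.

(** The steps entering and leaving the marked vertex are taken in the opposite order, so no other
    vertex moves. *)
Lemma flip_flag a : is_flag a -> is_flag (flip a).
Proof.
move=> /flagP fa; apply/flagP => i; rewrite /= !ffunE permM.
have [->|i0] := eqVneq i 0.
  rewrite add0r (negPf oner_neq0I) tpermL.
  rewrite -[1 in LHS]add0r fa -{1}[0 in LHS](addNr 1) fa.
  by rewrite -!addrA; congr (_ + _); rewrite addrC.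
have [->|i1] := eqVneq i (-1); first by rewrite addNr eqxx tpermR.
by rewrite -{1}(opprK 1) subr_eq0 (negPf i1) tpermD // eq_sym.
Qed.

Lemma flipK a : is_flag a -> flip (flip a) = a.
Proof.
move=> /flagP fa; case: a fa => x p /= fa; congr pair => /=; last first.
  by rewrite mulgA tperm2 mul1g.
apply/ffunP => i; rewrite !ffunE (negPf opp1_neq0I) permM tpermL.
by case: eqVneq => // ->; rewrite -fa addNr.
Qed.

Lemma flip_neq a : flip a != a.
Proof.
apply/eqP => /(congr1 (fun b : flagT => b.2 0)) /=; rewrite permM tpermL => /perm_inj/eqP.
by apply/negP.
Qed.

Lemma flip_door l a : door l a -> door l (flip a).
Proof.
move=> /doorP[fa H1 H2]; apply/doorP; split; first exact: flip_flag.
  by move=> i i0; rewrite ffunE (negPf i0); apply: H1.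
by move=> i j i0 j0; rewrite !ffunE (negPf i0) (negPf j0); apply: H2.
Qed.

Lemma turn_flag k a : is_flag a -> is_flag (turn k a).
Proof.
move=> /flagP fa; apply/flagP => i /=; rewrite !ffunE permM permE.
by rewrite addrAC fa.
Qed.

Lemma turn_turn k k' a : turn k' (turn k a) = turn (k' + k) a.
Proof.
case: a => x p; congr pair => /=.
  by apply/ffunP => i; rewrite !ffunE addrA.
by apply/permP => i; rewrite !permM !permE addrA.
Qed.

Lemma turn0 a : turn 0 a = a.
Proof.
case: a => x p; congr pair => /=.
  by apply/ffunP => i; rewrite !ffunE addr0.
by apply/permP => i; rewrite !permM !permE addr0.
Qed.

(* The other vertex of a door carrying the label of the marked vertex, unless that label is [0]. *)
Definition twin l a : 'I_n.+2 :=
  odflt 0 [pick k | (k != 0) && (l (a.1 k) == l (a.1 0))].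

(** By counting, the unmarked vertices of a door carry each nonzero label exactly once. *)
Lemma twinP l a : door l a -> l (a.1 0) != 0 ->
  twin l a != 0 /\ l (a.1 (twin l a)) = l (a.1 0).
Proof.
move=> /doorP[fa H1 H2] a0; rewrite /twin; case: pickP => [k /andP[? /eqP] //|no].
pose S := [set l (a.1 i) | i in [set~ 0]]%SET.
have SE : S = [set~ 0]%SET.
  apply/eqP; rewrite eqEcard; apply/andP; split.
    apply/fintype.subsetP => y /imsetP[i]; rewrite !inE => i0 e; rewrite e; exact: H1.
  rewrite card_in_imset // => i j; rewrite !inE => i0 j0; exact: H2.
have : l (a.1 0) \in S by rewrite SE !inE.
case/imsetP => k; rewrite !inE => k0 e.
by have := no k; rewrite k0 e eqxx.
Qed.

Lemma twin_unique l a k : door l a -> k != 0 -> l (a.1 k) = l (a.1 0) ->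
  twin l a = k.
Proof.
move=> da k0 e; have /doorP[fa H1 H2] := da.
have a0 : l (a.1 0) != 0 by rewrite -e; exact: H1.
by have [t0 te] := twinP da a0; apply: H2 => //; rewrite te.
Qed.

(** The old and the new marked vertex have the same label, so the labels off the mark stay the
    same. *)
Lemma turn_door l a k : door l a -> k != 0 -> l (a.1 k) = l (a.1 0) ->
  door l (turn k a).
Proof.
move=> /doorP[fa H1 H2] k0 e; apply/doorP; split; first exact: turn_flag.
  move=> i i0; rewrite ffunE; have [ik|ik] := eqVneq (i + k) 0; last exact: H1.
  by rewrite ik -e; exact: H1.
move=> i j i0 j0; rewrite !ffunE => E; apply: (addIr k).
have shift u v : u != 0 -> u + k = 0 -> l (a.1 (u + k)) = l (a.1 (v + k)) ->
    v != 0 -> u + k = v + k.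
  move=> u0 uk; rewrite uk -e => E' v0.
  have [-> //|vk] := eqVneq (v + k) 0.
  by have := H2 _ _ k0 vk E' => /eqP; rewrite -subr_eq0 opprD addrCA subrr addr0
    oppr_eq0 (negPf v0).
have [ik|ik] := eqVneq (i + k) 0; first exact: shift.
have [jk|jk] := eqVneq (j + k) 0; first by apply/esym/shift.
exact: H2.
Qed.

Lemma full_even l : ~~ odd #|[set a | full l a]%SET|.
Proof.
pose D := [set a | door l a]%SET; pose D0 := [set a in D | l (a.1 0) == 0]%SET.
have -> : [set a | full l a]%SET = D0.
  apply/finset.setP => a; rewrite !inE; apply/fullP/andP.
    move=> [fa a0 inj]; split; last exact/eqP.
    apply/doorP; split=> // [i i0|i j _ _ /inj//].
    by rewrite -a0; apply: contra i0 => /eqP/inj ->.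
  move=> [/doorP[fa H1 H2] /eqP a0]; split => // i j e.
  have [i0|i0] := eqVneq i 0; have [j0|j0] := eqVneq j 0.
  - by rewrite i0.
  - by move: (H1 _ j0); rewrite -e i0 a0.
  - by move: (H1 _ i0); rewrite e j0 a0.
  - exact: H2.
have evD : ~~ odd #|D|.
  apply: (@even_card_involution _ _ flip) => a; rewrite !inE => da.
  split; [exact: flip_door | apply: flipK | exact: flip_neq].
  by case/doorP: da.
have evD1 : ~~ odd #|D :\: D0|.
  apply: (@even_card_involution _ _ (fun a => turn (twin l a) a)) => a.
  rewrite !inE => /andP[]; rewrite negb_and orbC => + da; rewrite da orbF => a0.
  have [t0 te] := twinP da a0; have dt := turn_door da t0 te.
  (* Seen from the new mark the twin is the old marked vertex, so turning twice restores the
     flag. *)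
  have tw : twin l (turn (twin l a) a) = - twin l a.
    apply: twin_unique => //; first by rewrite oppr_eq0.
    by rewrite !ffunE add0r addNr te.
  split.
  - by rewrite dt /= andbT !ffunE add0r te.
  - by rewrite tw turn_turn addNr turn0.
  - apply/eqP => /(congr1 (fun b : flagT => b.2 0)) /=; rewrite permM permE add0r.
    by move/perm_inj/eqP; apply/negP.
move: evD evD1; rewrite -(cardsID D0 D) oddD.
have -> : D :&: D0 = D0 by apply/finset.setIidPr/fintype.subsetP => a; rewrite inE => /andP[].
by case: odd => //; case: odd.
Qed.

Lemma val_add1 (u : 'I_m.+2) : u + 1 != 0 -> (u + 1)%R = u.+1 :> nat.
Proof.
move=> u0; have le := ltn_ord u.
have E : (u + 1)%R = (u.+1 %% m.+2)%N :> nat by rewrite /= [(1 %% _)%N]modn_small // addn1.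
rewrite E; have [lt|ge] := ltnP u.+1 m.+2; first by rewrite modn_small.
have um : u.+1 = m.+2 by apply/eqP; rewrite eqn_leq le ge.
by case/negP: u0; apply/eqP/val_inj; rewrite [LHS]E um modnn.
Qed.

Local Notation wid := (widen_ord (leqnSn n.+1)).

(** Coordinate [c] changes at two places of the cycle only: it rises at the step of index [c] and
    falls at the step of index [n.+1]. The inverse of [a.2] gives their positions, counted from
    [i]. *)
Lemma flag_coord a i r c : is_flag a -> (r <= n.+2)%N ->
  a.1 (i + r%:R) c =
  a.1 i c + (((a.2)^-1%g (wid c) - i)%R < r)%N%:R
          - (((a.2)^-1%g ord_max - i)%R < r)%N%:R.
Proof.
move=> /flagP fa; set p := _ (wid c); set q := _ ord_max.
elim: r => [|r IH] rn; first by rewrite addr0 !ltn0 addr0 subr0.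
have key (u : 'I_n.+2) (v : 'I_n.+2) : (a.2)^-1%g v = u ->
    ((u - i)%R < r.+1)%N%:R =
    ((u - i)%R < r)%N%:R + (a.2 (i + r%:R) == v :> nat)%:R :> 'I_m.+2.
  move=> <-; set w := _ - i.
  have -> : (a.2 (i + r%:R) == v :> nat) = (w == r :> nat).
    apply/idP/idP => /eqP E.
      have -> : w = r%:R.
        by rewrite /w -(val_inj E) permK addrC addKr.
      by rewrite Zp_nat /= modn_small.
    have -> : i + r%:R = (a.2)^-1%g v.
      have <- : w = r%:R by rewrite -E natr_Zp.
      by rewrite addrC subrK.
    by rewrite permKV.
  by rewrite ltnS leq_eqVlt; case: (ltngtP w r) => _ /=; rewrite ?addr0 ?add0r.
rewrite mulrSr addrA fa ffunE IH; last exact: ltnW.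
rewrite (key p (wid c)) // (key q ord_max) // ffunE /=.
rewrite -!addrA; congr (_ + _); rewrite opprD; set A := (_ < _)%N%:R.
by rewrite [RHS]addrCA !addrA; congr (_ - _); rewrite addrC addrA.
Qed.

(** As coordinate [c] is never [0] on the flag, no step wraps around, and the same count holds in
    the natural numbers; the terms are arranged to avoid subtraction. *)
Lemma flag_coordN a i r c : is_flag a -> (r <= n.+2)%N ->
  (forall k, a.1 k c != 0) ->
  (a.1 (i + r%:R)%R c + (((a.2)^-1%g ord_max - i)%R < r) =
   a.1 i c + (((a.2)^-1%g (wid c) - i)%R < r))%N.
Proof.
move=> fa rn H; have := flag_coord i c fa rn.
have := H (i + r%:R); have := H i.
set u := a.1 i c; set w := a.1 _ c => u0 w0.
case: (_ < r)%N; case: (_ < r)%N => /=; rewrite ?addn0.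
- by rewrite addrK => ->.
- by rewrite subr0 => E; rewrite E val_add1 -?E // addn1.
- rewrite addr0 => E; have {}E : u = w + 1 by rewrite E subrK.
  by rewrite E val_add1 -?E // addn1.
- by rewrite addr0 subr0 => ->.
Qed.

Lemma flag_close a i k c : is_flag a -> (forall k, a.1 k c != 0) ->
  (a.1 i c <= (a.1 k c).+1)%N.
Proof.
move=> fa H; have := @flag_coordN a i (k - i)%R c fa (ltnW (ltn_ord _)) H.
rewrite natr_Zp addrC subrK; do 2!case: (_ < _)%N; rewrite /=; lia.
Qed.

(** Label [0] means that [P] fails everywhere, label [c.+1] that [c] is the last coordinate where it
    holds. *)
Definition max_label (P : pred 'I_n.+1) : 'I_n.+2 :=
  inord (\max_(c | P c) c.+1).

Lemma max_labelE (P : pred 'I_n.+1) : max_label P = (\max_(c | P c) c.+1)%N :> nat.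
Proof. by rewrite inordK // ltnS; apply/bigmax_leqP => c _. Qed.

Lemma max_label_lt (P : pred 'I_n.+1) (c : 'I_n.+1) : P c -> (c < max_label P)%N.
Proof. by rewrite max_labelE => Pc; apply: (@leq_bigmax_cond _ P (fun c => c.+1)). Qed.

Lemma max_label_eq0 (P : pred 'I_n.+1) : (forall c, ~~ P c) -> max_label P = 0.
Proof. by move=> H; apply: val_inj; rewrite /= max_labelE big_pred0 // => c; apply: negbTE. Qed.

Lemma max_label_eqS (P : pred 'I_n.+1) (c : 'I_n.+1) : max_label P = c.+1 :> nat -> P c.
Proof.
rewrite max_labelE => E; have : (0 < #|P|)%N.
  rewrite lt0n; apply/negP => /eqP/card0_eq P0.
  by move: E; rewrite big_pred0.
move=> /(eq_bigmax_cond (fun c : 'I_n.+1 => c.+1)) [c' Pc'].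
by rewrite E => -[/val_inj ->].
Qed.

Variable C : nat.
Hypotheses (C2 : (2 <= C)%N) (Cm : (C <= m.+1)%N).

(** The labelling that the zero map produces on a grid whose origin has all coordinates [C]. *)
Definition std_label (v : V) := max_label (fun c => (C <= v c)%N).

Lemma std_label_lt (v : V) (c : 'I_n.+1) : (C <= v c)%N -> (c < std_label v)%N.
Proof. exact: (@max_label_lt (fun c => C <= v c)%N). Qed.

(** The path from the point with all coordinates [C.-1] to the one with all coordinates [C], raising
    the coordinates one at a time in their order. *)
Definition std_flag : flagT :=
  ([ffun i : 'I_n.+2 => [ffun c : 'I_n.+1 => inord (C.-1 + (c < i))]], 1%g).

Definition untouched a := [forall i, forall c, a.1 i c != 0].

Lemma untouchedP a : reflect (forall i c, a.1 i c != 0) (untouched a).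
Proof.
apply: (iffP forallP) => H i; first by move=> c; move/forallP: (H i).
by apply/forallP.
Qed.

Let std_val i c : std_flag.1 i c = (C.-1 + (c < i))%N :> nat.
Proof. by rewrite !ffunE inordK //; case: (c < i)%N; lia. Qed.

Lemma std_flag_full : full std_label std_flag /\ untouched std_flag.
Proof.
have lE i : std_label (std_flag.1 i) = i.
  apply: val_inj => /=; rewrite max_labelE; apply/eqP; rewrite eqn_leq.
  apply/andP; split.
    by apply/bigmax_leqP => c; rewrite std_val; case: ltnP => //; lia.
  case: (posnP i) => [->//|i0]; have lt : (i.-1 < n.+1)%N by have := ltn_ord i; lia.
  have Pc : (C <= std_flag.1 i (Ordinal lt))%N.
    by rewrite std_val /= prednK // leqnn; lia.
  by have := std_label_lt Pc; rewrite max_labelE /= prednK.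
split; last first.
  apply/untouchedP => i c; apply: contraTneq isT => /(congr1 val) /=.
  by rewrite std_val /=; lia.
apply/fullP; split; [|exact: lE|by move=> i j; rewrite !lE].
apply/flagP => i; apply/ffunP => c; rewrite perm1 [RHS]ffunE.
have nE u (b : 'I_m.+2) : b = u :> nat -> b = u%:R by move=> <-; rewrite natr_Zp.
rewrite (nE _ _ (std_val i c)) (nE _ _ (std_val (i + 1) c)) ffunE.
rewrite !natrD -!addrA; congr (_ + _).
have [im|im] := eqVneq (i : nat) n.+1.
  have -> : i + 1 = 0.
    by apply: val_inj => /=; rewrite im [(1 %% _)%N]modn_small // addn1 modnn.
  have cn : (n.+1 == c) = false by have := ltn_ord c; lia.
  by rewrite im cn ltn_ord ltn0 /= add0r subrr.
have -> : (i + 1)%R = i.+1 :> nat.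
  have := ltn_ord i => lt; rewrite /= [(1 %% _)%N]modn_small // addn1 modn_small //.
  by move/eqP: im; lia.
by rewrite subr0 ltnS leq_eqVlt eq_sym; case: ltngtP; rewrite /= ?addr0 ?add0r.
Qed.

Lemma incr_inj_id (g : 'I_n.+2 -> 'I_n.+2) : injective g ->
  (forall i j, (i <= j)%N -> (g i <= g j)%N) -> forall i, g i = i.
Proof.
move=> ginj gm.
have gs i j : (i < j)%N -> (g i < g j)%N.
  move=> ij; rewrite ltn_neqAle gm ?(ltnW ij) // andbT.
  by apply: contraTneq ij => /val_inj/ginj ->; rewrite ltnn.
have lo (k : nat) : forall i, i = k :> nat -> (k <= g i)%N.
  elim: k => // k IH i ik; have kn : (k < n.+2)%N by have := ltn_ord i; lia.
  apply: leq_ltn_trans (IH (Ordinal kn) erefl) _; apply: gs; by rewrite ik /=.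
have hi (k : nat) : forall i, (i + k = n.+1)%N -> (g i + k <= n.+1)%N.
  elim: k => [i _|k IH i ik]; first by rewrite addn0 -ltnS.
  have kn : (i.+1 < n.+2)%N by lia.
  have := IH (Ordinal kn) _; have := gs i (Ordinal kn) (ltnSn _); rewrite /=; lia.
move=> i; apply: val_inj => /=; have := lo i i erefl.
have := hi (n.+1 - i)%N i _; have := ltn_ord i; lia.
Qed.

(** If the step [-(1, ..., 1)] did not close the cycle, the last vertex would lie below the first
    and also have label [0]. So coordinates only grow from the first vertex on, the labels are
    increasing and distinct, and vertex [r] has label [r]; this forces coordinate [c] to rise from
    [C.-1] exactly at step [c]. *)
Lemma std_flag_unique a : full std_label a -> untouched a -> a = std_flag.
Proof.
move=> /fullP[fa a0 inj] /untouchedP ua.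
set p := fun c => (a.2)^-1%g (wid c); set q := (a.2)^-1%g ord_max.
have X (r : 'I_n.+2) c : (a.1 r c + (q < r) = a.1 0%R c + (p c < r))%N.
  have := @flag_coordN a 0 r c fa (ltnW (ltn_ord _)) (fun k => ua k c).
  by rewrite add0r natr_Zp !subr0.
have X0 c : (a.1 0%R c < C)%N.
  by rewrite ltnNge; apply/negP => /std_label_lt; rewrite a0.
have qm : q = ord_max.
  apply/eqP; rewrite -val_eqE eqn_leq -ltnS ltn_ord /= leqNgt; apply/negP => qn.
  have : std_label (a.1 ord_max) = std_label (a.1 0).
    rewrite a0; apply: max_label_eq0 => c; rewrite -ltnNge.
    apply: leq_ltn_trans (X0 c).
    by have := X ord_max c; rewrite qn /=; case: (_ < _)%N => /=; lia.
  by move/inj/(congr1 val).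
have {}X (r : 'I_n.+2) c : (a.1 r c = a.1 0%R c + (p c < r) :> nat)%N.
  by rewrite -X qm [(_ < r)%N]ltnNge -ltnS ltn_ord addn0.
have lE r : std_label (a.1 r) = r.
  apply: (@incr_inj_id (fun r => std_label (a.1 r))) => // i j ij.
  have sub c : (C <= a.1 i c)%N -> (C <= a.1 j c)%N.
    rewrite (X i) (X j); have [pi|] := ltnP (p c) i; last by case: (_ < _)%N; lia.
    by rewrite (leq_trans pi ij).
  rewrite !max_labelE; apply/bigmax_leqP => c /sub Pc.
  by have := @leq_bigmax_cond _ (fun c => C <= a.1 j c)%N (fun c : 'I_n.+1 => c.+1) c Pc.
have key c : (a.1 0%R c = C.-1 :> nat) /\ p c = wid c.
  have h1 : (C <= a.1 (inord c.+1) c)%N.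
    apply: (@max_label_eqS (fun d => (C <= a.1 (inord c.+1) d)%N)).
    by rewrite -/(std_label _) lE inordK // ltnS.
  have h2 : ~~ (C <= a.1 (wid c) c)%N.
    by apply/negP => /std_label_lt; rewrite lE ltnn.
  move: h1 h2 (X0 c); rewrite (X (inord _)) (X (wid c)) -ltnNge (inordK (ltn_ord c : (c.+1 < n.+2)%N)) /= => h1 h2 h3.
  split; first by move: h1; case: (p c < _)%N => /=; lia.
  apply/val_inj/eqP => /=; rewrite eqn_leq; move: h1 h2.
  by case: leqP; case: ltnP => //=; rewrite ?ltnS; lia.
have p1 : a.2 = 1%g.
  apply/permP => i; rewrite perm1; apply: (@perm_inj _ (a.2)^-1%g); rewrite permK.
  have [im|im] := eqVneq (i : nat) n.+1.
    by have -> : i = ord_max by apply: val_inj.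
  have lt : (i < n.+1)%N by have := ltn_ord i; move/eqP: im; lia.
  have -> : i = wid (Ordinal lt) by apply: val_inj.
  exact: esym (key (Ordinal lt)).2.
rewrite (surjective_pairing a) p1; congr pair; apply/ffunP => i; apply/ffunP => c.
by apply: val_inj; rewrite [RHS]std_val /= (X i); case: (key c) => -> ->.
Qed.

Theorem torus_sperner l :
  (forall v : V, (exists c, v c \in [:: 0; 1; -1]) -> l v = std_label v) ->
  exists a, full l a /\ forall i c, a.1 i c != 0.
Proof.
move=> band.
pose Fu l := [set a | full l a]%SET; pose U := [set a | untouched a]%SET.
(* If coordinate [c] vanishes at one vertex of a flag, it is [0], [1] or [-1] at all of them, and
   there the two labellings agree. *)
have touchE : Fu l :\: U = Fu std_label :\: U.
  apply/finset.setP => a; rewrite !inE; case: (boolP (untouched a)) => //= /forallPn[i].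
  case/forallPn => c; rewrite negbK => /eqP ac; case: (boolP (is_flag a)) => fa; last first.
    by rewrite /full (negPf fa).
  have lE k : l (a.1 k) = std_label (a.1 k).
    apply: band; exists c; have := @flag_coord a i (k - i)%R c fa (ltnW (ltn_ord _)).
    rewrite natr_Zp addrC subrK => ->; rewrite ac add0r.
    by do 2!case: (_ < _)%N; rewrite ?subrr ?subr0 ?add0r !inE eqxx ?orbT.
  rewrite /full lE; congr [&& _, _ & _]; apply/injectiveP/injectiveP => H u v e; apply: H;
    by rewrite ?lE // -?lE.
have stdU : Fu std_label :&: U = [set std_flag]%SET.
  apply/finset.setP => a; rewrite !inE; apply/andP/eqP => [[]|->].
    exact: std_flag_unique.
  by case: std_flag_full.
have : odd #|Fu l :&: U|.
  have := full_even l; have := full_even std_label.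
  rewrite -/(Fu l) -/(Fu std_label) -(cardsID U (Fu l)) -(cardsID U (Fu std_label)).
  by rewrite touchE stdU cards1 !oddD /=; case: (odd #|Fu l :&: U|) => //; case: odd.
move=> o; have /card_gt0P[a] : (0 < #|Fu l :&: U|)%N by move: o; case: #|_|.
by rewrite !inE => /andP[fa /untouchedP ua]; exists a.
Qed.

End TorusSperner.

(** * Brouwer's fixed point theorem *)

Local Open Scope classical_set_scope.

(** * The entrywise maximum norm *)

Section MatrixNorm.
Variable R : realType.

Lemma mx_norm_le p q (x : 'M[R]_(p, q)) (B : R) :
  0 <= B -> (forall i j, `|x i j| <= B) -> `|x| <= B.
Proof.
by move=> B0 H; rewrite [leLHS]/Num.norm /= mx_normrE; apply/bigmax_leP; split.
Qed.

Lemma mx_entry_le p q (x : 'M[R]_(p, q)) i j : `|x i j| <= `|x|.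
Proof.
by rewrite [leRHS]/Num.norm /= mx_normrE; apply/bigmax_geP; right; exists (i, j).
Qed.

Lemma mx_norm_lt p q (x : 'M[R]_(p, q)) (B : R) :
  0 < B -> (forall i j, `|x i j| < B) -> `|x| < B.
Proof.
by move=> B0 H; rewrite [ltLHS]/Num.norm /= mx_normrE; apply/bigmax_ltP; split.
Qed.

Lemma mxvec_norm p q (x : 'M[R]_(p, q)) : `|mxvec x| = `|x|.
Proof.
apply/eqP; rewrite eq_le; apply/andP; split; apply: mx_norm_le => // i j.
  by rewrite ord1; case/mxvec_indexP: j => u v; rewrite mxvecE mx_entry_le.
by rewrite -mxvecE mx_entry_le.
Qed.

Lemma mulmx_norm_le p q r (x : 'M[R]_(p, q)) (y : 'M[R]_(q, r)) :
  `|x *m y| <= q%:R * `|x| * `|y|.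
Proof.
apply: mx_norm_le => [|i j]; first by rewrite !mulr_ge0.
rewrite mxE; apply: le_trans (ler_norm_sum _ _ _) _.
apply: (@le_trans _ _ (\sum_(k < q) `|x| * `|y|)).
  by apply: ler_sum => k _; rewrite normrM ler_pM // mx_entry_le.
by rewrite sumr_const card_ord -mulrA mulr_natl.
Qed.

End MatrixNorm.

(** Every bounded sequence converges along one and the same such ultrafilter, so limits at all times
    can be taken at once, without extracting subsequences. *)
Lemma ultra_eventually :
  exists U : set_system nat, UltraFilter U /\ forall k0, U [set k | (k0 <= k)%N].
Proof.
have [U [UU sU]] := @ultraFilterLemma nat \oo _.
by exists U; split=> // k0; apply: sU; exact: nbhs_infty_ge.
Qed.

(** * Limits of bounded sequences along an ultrafilter *)

Section UltraLimit.
Variables (R : realType) (U : set_system nat).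
Hypothesis UU : UltraFilter U.

(** Compactness of the segment gives a cluster point. For an ultrafilter it is a limit: otherwise
    the indices where [u] is far from it would form a set of [U]. *)
Lemma ultra_lim (u : nat -> R) (B : R) : (forall k, `|u k| <= B) ->
  exists l, forall e, 0 < e -> U [set k | `|u k - l| < e].
Proof.
move=> uB.
have FA : (u @ U) `[- B, B].
  rewrite /nbhs /=; change (U (u @^-1` `[- B, B])).
  by apply: filterE => k; rewrite /= in_itv /= -ler_norml.
have [l [_ lc]] := @segment_compact R (- B) B (u @ U) _ FA.
exists l => e e0.
have [//|Un] := in_ultra_setVsetC [set k | `|u k - l| < e] UU.
have [] := lc [set y | ~ `|y - l| < e] (ball l e) Un (nbhsx_ballx _ _ e0).
by move=> y [] /= ny; rewrite -ball_normE /= distrC.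
Qed.

Lemma ultra_lim_mx p q (u : nat -> 'M[R]_(p, q)) (B : R) :
  (forall k, `|u k| <= B) ->
  exists l, forall e, 0 < e -> U [set k | `|u k - l| < e].
Proof.
move=> uB.
have H (ij : 'I_p * 'I_q) : exists l : R, forall e, 0 < e ->
    U [set k | `|u k ij.1 ij.2 - l| < e].
  by apply: (@ultra_lim _ B) => k; apply: le_trans (mx_entry_le _ _ _) _.
have {H} [l lP] := choice H.
exists (\matrix_(i, j) l (i, j)) => e e0.
have HU : U [set k | forall ij : 'I_p * 'I_q, `|u k ij.1 ij.2 - l ij| < e].
  by apply: (@filter_forall _ _ (fun ij k => `|u k ij.1 ij.2 - l ij| < e)) => ij; exact: lP.
apply: filterS HU => k H; apply: mx_norm_lt => // i j.
by rewrite !mxE; exact: (H (i, j)).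
Qed.

End UltraLimit.

Section Brouwer.
Variable R : realType.

Definition eps_continuous (V W : normedModType R) (G : V -> W) :=
  forall x e, 0 < e -> exists2 d : R, 0 < d &
    forall y, `|y - x| < d -> `|G y - G x| < e.

(** Grid points are labelled by the last coordinate in which [x - G x] is nonnegative, with [G] cut
    off to [0] outside the ball of radius [K]. In a full simplex the vertex labelled [0] is the
    required [x], and the vertex labelled [c.+1] is the [y] for [c]. *)
Lemma sign_change_approx n (G : 'rV[R]_n.+1 -> 'rV[R]_n.+1) (K k : nat) :
  exists x : 'rV[R]_n.+1, forall c, exists y : 'rV[R]_n.+1,
    [/\ `|x - y| <= k.+1%:R^-1,
     x 0 c - (if `|x| <= K%:R then G x else 0) 0 c < 0 &
     0 <= y 0 c - (if `|y| <= K%:R then G y else 0) 0 c].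
Proof.
(* Here [m.+2 = 2 C + 1], so the grid of mesh [1 / k.+1] fills the cube of half-side [K + 2], and
   coordinate [C] stands for the real number [0]. *)
pose C := (k.+1 * K.+2)%N; pose m := (C + C).-2.+1.
have C2 : (2 <= C)%N by rewrite /C; nia.
have Cm : (C <= m.+1)%N by rewrite /m; lia.
pose pt (v : {ffun 'I_n.+1 -> 'I_m.+2}) : 'rV[R]_n.+1 :=
  \row_c (((v c)%:R - C%:R) / k.+1%:R).
pose Gc (x : 'rV[R]_n.+1) := if `|x| <= K%:R then G x else 0.
pose l (v : {ffun 'I_n.+1 -> 'I_m.+2}) :=
  max_label (fun c => 0 <= pt v 0 c - Gc (pt v) 0 c).
have k0 : 0 < k.+1%:R :> R by rewrite ltr0n.
have [a [/fullP[fa a0 inj] ua]] : exists a, full l a /\ forall i c, a.1 i c != 0.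
  apply: (torus_sperner C2 Cm) => v [c vc].
  (* A coordinate [0], [1] or [-1] puts the point within one mesh of the boundary of the cube, where
     the cut-off map is [0] and the label is the standard one. *)
  have far : K%:R < `|pt v|.
    apply: lt_le_trans (mx_entry_le _ 0 c); rewrite mxE normrM normfV.
    rewrite (ger0_norm (ltW k0)) ltr_pdivlMr // -natrM.
    have CE : C%:R = (K * k.+1)%:R + 2 * k.+1%:R :> R by rewrite /C -natrM -natrD; congr _%:R; lia.
    have k1 : 1 <= k.+1%:R :> R by rewrite ler1n.
    have : (v c <= 1)%N \/ v c = m.+1 :> nat.
      move: vc; rewrite !inE => /or3P[]/eqP->; [by left|by left|right].
      by rewrite /= subn1 modn_small.
    case=> [v1|->].
      have v1R : (v c)%:R <= 1 :> R by rewrite lern1.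
      by rewrite ltr_normr; apply/orP; right; lra.
    have -> : m.+1%:R = C%:R + C%:R :> R by rewrite -natrD; congr _%:R; rewrite /m; lia.
    by rewrite ltr_normr; apply/orP; left; lra.
  rewrite /l /std_label; congr max_label; apply/funext => d.
  rewrite /Gc [_ <= K%:R]leNgt far /= !mxE subr0 pmulr_lge0 ?invr_gt0 //.
  by rewrite subr_ge0 ler_nat.
exists (pt (a.1 0)) => c.
have lc : l (a.1 0) = 0 :> nat by rewrite a0.
have [i ic] : exists i, l (a.1 i) = inord c.+1.
  have /injF_onto := inj.
  by move=> /(_ (inord c.+1)); case/codomP => i ->; exists i.
exists (pt (a.1 i)); split.
- apply: mx_norm_le => [|u d]; first by rewrite invr_ge0 ltW.
  rewrite !mxE -mulrBl opprB addrA addrNK normrM normfV (ger0_norm (ltW k0)).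
  rewrite ler_pdivrMr // mulVf ?gt_eqF //.
  have h1 := flag_close 0 i fa (fun k => ua k d).
  have h2 := flag_close i 0 fa (fun k => ua k d).
  rewrite ler_norml; apply/andP; split.
    by rewrite lerBrDr addrC lerBlDr natr1 ler_nat.
  by rewrite lerBlDr addrC natr1 ler_nat.
- rewrite ltNge; apply/negP => H.
  by have := @max_label_lt _ (fun c => 0 <= pt (a.1 0) 0 c - Gc (pt (a.1 0)) 0 c) c H;
    rewrite -/(l _) lc.
- apply: (@max_label_eqS _ (fun c => 0 <= pt (a.1 i) 0 c - Gc (pt (a.1 i)) 0 c)).
  by rewrite -/(l _) ic inordK // ltnS.
Qed.

(** The points of [sign_change_approx] for finer and finer grids have an ultralimit [z] of norm at
    most [M < K]. Near [z] the cut-off is inactive, and the sign changes force every coordinate of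
    [z - G z] to vanish. *)
Lemma brouwer_rV n (G : 'rV[R]_n -> 'rV[R]_n) (M : R) :
  eps_continuous G -> (forall x, `|G x| <= M) -> exists x, G x = x.
Proof.
case: n G => [|n] G Gc GM; first by exists 0; apply/rowP => -[].
have M0 : 0 <= M by apply: le_trans (GM 0).
pose K := (Num.truncn M).+1; have MK : M < K%:R by rewrite /K truncnS_gt.
have [h hE] : exists h : nat -> R, forall k, h k = k.+1%:R^-1 by eexists.
have [x xP] : exists x : nat -> 'rV[R]_n.+1, forall k c, exists y : 'rV[R]_n.+1,
    [/\ `|x k - y| <= h k,
     x k 0 c - (if `|x k| <= K%:R then G (x k) else 0) 0 c < 0 &
     0 <= y 0 c - (if `|y| <= K%:R then G y else 0) 0 c].
  have [x xP] := choice (sign_change_approx G K).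
  by exists x => k c; rewrite hE.
have trunc_le z c : `|(if `|z| <= K%:R then G z else 0) 0 c| <= M.
  by case: ifP => _; rewrite ?mxE ?normr0 //; apply: le_trans (GM z); apply: mx_entry_le.
have h1 k : h k <= 1 by rewrite hE invf_le1 // ler1n.
(* The upper bound comes from the sign at [x k], the lower one from the sign at the nearby [y]. *)
have xb k c : - M - h k <= x k 0 c <= M.
  have [y [xy + +]] := xP k c.
  have := trunc_le (x k) c; have := trunc_le y c; rewrite !ler_norml.
  have := le_trans (mx_entry_le (x k - y) 0 c) xy; rewrite !mxE ler_norml.
  move: (fun_of_matrix (if `|y| <= _ then _ else _) 0 c) (fun_of_matrix (if `|x k| <= _ then _ else _) 0 c) => g1 g2.
  by move=> /andP[? ?] /andP[? ?] /andP[? ?] ? ?; apply/andP; split; lra.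
have [U [UU Uinf]] := ultra_eventually.
have [|z zP] := @ultra_lim_mx R U UU _ _ x (M + 1).
  move=> k; apply: mx_norm_le => [|i c]; first by lra.
  rewrite ord1 ler_norml; have /andP[? ?] := xb k c; have := h1 k => ?.
  by apply/andP; split; lra.
have Uh (e : R) : 0 < e -> U [set k | h k < e].
  move=> e0; apply: filterS (Uinf (Num.truncn e^-1)) => k /= ek; rewrite hE.
  rewrite invf_plt ?posrE //; apply: lt_le_trans (truncnS_gt _) _.
  by rewrite ler_nat.
have zM : `|z| <= M.
  apply: mx_norm_le => // i c; rewrite ord1; apply/ler_addgt0Pr => e e0.
  have e20 : 0 < e / 2 by lra.
  have [k [/= zk hk]] := filter_ex (filterI (zP _ e20) (Uh _ e20)).
  have := le_lt_trans (mx_entry_le (x k - z) 0 c) zk; rewrite !mxE ltr_norml.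
  move=> /andP[? ?]; have /andP[? ?] := xb k c; rewrite ler_norml.
  by apply/andP; split; lra.
exists z; apply/rowP => c; apply/eqP; rewrite eq_sym -subr_eq0 -normr_le0.
apply/ler_addgt0Pr => e e0; rewrite add0r.
have e20 : 0 < e / 2 by lra.
have [d d0 dP] := Gc z _ e20.
(* Both [x k] and [y] lie within [2 r] of [z]. The three bounds serve the continuity of [G] at [z],
   keep both points inside radius [K], and make [2 r] at most [e / 2]. *)
pose r := Num.min (d / 2) (Num.min ((K%:R - M) / 2) (e / 4)).
have r0 : 0 < r by rewrite !lt_min; apply/and3P; split; lra.
have [k [/= zk hk]] := filter_ex (filterI (zP _ r0) (Uh _ r0)).
move: zk hk; rewrite !lt_min => /and3P[zk1 zk2 zk3] /and3P[hk1 hk2 hk3].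
have [y [xy]] := xP k c.
have zyn : `|y - z| <= `|x k - y| + `|x k - z|.
  by rewrite (distrC (x k) y); apply: ler_distD.
have small w : `|w - z| < K%:R - M -> `|w| <= K%:R.
  by move=> wz; have := ler_normD (w - z) z; rewrite subrK; lra.
rewrite !small; try lra.
have Gx := le_lt_trans (mx_entry_le _ 0 c) (dP (x k) ltac:(lra)).
have Gy := le_lt_trans (mx_entry_le _ 0 c) (dP y ltac:(lra)).
have zx := mx_entry_le (x k - z) 0 c; have zy := mx_entry_le (y - z) 0 c.
move: Gx Gy zx zy; rewrite !mxE !ltr_norml !ler_norml.
move=> /andP[? ?] /andP[? ?] /andP[? ?] /andP[? ?] ? ?; apply/andP; split; lra.
Qed.

Theorem brouwer_mx p q (G : 'M[R]_(p, q) -> 'M[R]_(p, q)) (M : R) :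
  eps_continuous G -> (forall x, `|G x| <= M) -> exists x, G x = x.
Proof.
move=> Gc GM; have [|x|x xE] := @brouwer_rV _ (fun x => mxvec (G (vec_mx x))) M.
- move=> x e e0; have [d d0 dP] := Gc (vec_mx x) e e0; exists d => // y yx.
  by rewrite -raddfB /= mxvec_norm; apply: dP; rewrite -raddfB -mxvec_norm vec_mxK.
- by rewrite mxvec_norm.
- by exists (vec_mx x); rewrite -[LHS]mxvecK xE.
Qed.

End Brouwer.

(** * Continuity, derivatives and a mean value inequality *)

Section Preliminaries.
Variable R : realType.

Lemma within_continuous_epsP (X V : normedModType R) (D : set X) (u : X -> V) :
  {within D, continuous u} <->
  forall t, D t -> forall e, 0 < e -> exists2 d, 0 < d &
    forall s, D s -> `|s - t| < d -> `|u s - u t| < e.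
Proof.
split=> [/subspace_continuousP uc t Dt e e0|H].
  have /cvgrPdist_lt/(_ e e0) := uc t Dt.
  rewrite near_withinE => /nbhs_normP[d /= d0 dP]; exists d => // s Ds st.
  by rewrite distrC; apply: dP; rewrite //= distrC.
apply/subspace_continuousP => t Dt; apply/cvgrPdist_lt => e e0.
have [d d0 dP] := H t Dt e e0; rewrite near_withinE; apply/nbhs_normP.
by exists d => //= s st Ds; rewrite distrC; apply: dP; rewrite // distrC.
Qed.

Lemma has_deriv_on_epsP (V : normedModType R) (D : set R) (y dy : R -> V) :
  has_deriv_on D y dy <->
  forall t, D t -> forall e, 0 < e -> exists2 d, 0 < d &
    forall s, D s -> `|s - t| < d ->
      `|y s - y t - (s - t) *: dy t| <= e * `|s - t|.
Proof.
split=> H t Dt.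
  move=> e e0; have /cvgrPdist_le/(_ e e0) := H t Dt.
  rewrite near_withinE => /nbhs_normP[d /= d0 dP]; exists d => // s Ds st.
  have [->|nst] := eqVneq s t; first by rewrite !subrr scale0r subr0 !normr0 mulr0.
  have hst : s - t != 0 by rewrite subr_eq0.
  have := dP (s - t); rewrite /= sub0r normrN (addrC t) subrK => /(_ st hst Ds) /= le.
  rewrite -ler_pdivrMr ?normr_gt0 // mulrC -normfV -normrZ scalerBr scalerA.
  by rewrite mulVf // scale1r distrC.
apply/cvgrPdist_le => e e0; have [d d0 dP] := H t Dt e e0.
rewrite near_withinE; apply/nbhs_normP; exists d => // h /=; rewrite sub0r normrN.
move=> hd h0 /= Dth; have := dP _ Dth; rewrite (addrC t) addrK => /(_ hd) le.
rewrite distrC -[X in _ - X](@scalerK _ _ h) // -scalerBr normrZ normfV.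
by rewrite mulrC ler_pdivrMr ?normr_gt0 // [t + h]addrC.
Qed.

Lemma fin_min (I : finType) (Q : I -> R -> Prop) :
  (forall i, exists2 d, 0 < d & forall d', d' <= d -> Q i d') ->
  exists2 d, 0 < d & forall i, Q i d.
Proof.
move=> H.
have {H} H i : exists d, 0 < d /\ forall d', d' <= d -> Q i d'.
  by have [d d0 dP] := H i; exists d.
have [d dP] := choice H.
exists (\big[Order.min/1]_i d i).
  by apply/bigmin_gtP; split=> // i _; case: (dP i).
by move=> i; apply: (dP i).2; exact: bigmin_le_cond.
Qed.

(* A continuous induction: only left lower semicontinuity and right Dini derivatives are used. *)
Lemma right_dini_le (phi : R -> R) (a b : R) : a <= b ->
  (forall t, a < t -> t <= b -> forall e, 0 < e -> exists2 d, 0 < d &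
    forall s, a <= s -> s < t -> t - s < d -> phi t - phi s <= e) ->
  (forall t, a <= t -> t < b -> forall e, 0 < e -> exists2 d, 0 < d &
    forall s, t < s -> s <= b -> s - t < d -> phi s - phi t <= e * (s - t)) ->
  phi b <= phi a.
Proof.
move=> ab lc rd; apply/ler_addgt0Pr => e' e'0.
pose e := e' / (b - a + 1); have ba1 : 0 < b - a + 1 by lra.
have e0 : 0 < e by rewrite divr_gt0.
have eba : e * (b - a) <= e'.
  by rewrite /e mulrAC ler_pdivrMr // ler_pM2l //; lra.
(* The points up to which [phi] stays below a line of slope [e]. The left condition puts the
   supremum of [S] into [S], and the right condition pushes it beyond any point before [b]. *)
pose S := [set s | a <= s <= b /\ forall u, a <= u -> u <= s ->
  phi u <= phi a + e * (u - a)].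
have Sa : S a.
  split; first by rewrite lexx ab.
  move=> u au ua; have -> : u = a by apply/eqP; rewrite eq_le au ua.
  by rewrite subrr mulr0 addr0.
have Sb : ubound S b by move=> s [/andP[]].
have hS : has_sup S by split; [exists a | exists b].
pose c := sup S.
have ac : a <= c by apply: (ub_le_sup hS.2).
have cb : c <= b by apply: ge_sup => //; exists a.
have Slt u : a <= u -> u < c -> phi u <= phi a + e * (u - a).
  move=> au uc; have [s Ss us] := sup_gt (ex_intro _ a Sa) uc.
  by apply: Ss.2 => //; exact: ltW.
have phic : phi c <= phi a + e * (c - a).
  have [ca|nca] := eqVneq c a; first by rewrite ca subrr mulr0 addr0.
  have aLc : a < c by rewrite lt_neqAle eq_sym nca.
  apply/ler_addgt0Pr => eta eta0; have [d d0 dP] := lc c aLc cb eta eta0.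
  pose s := Num.max a (c - d / 2).
  have sc : s < c by rewrite gt_max aLc /=; lra.
  have as_ : a <= s by rewrite le_max lexx.
  have cs : c - s < d.
    by have : c - d / 2 <= s; [rewrite le_max lexx orbT | lra].
  have := dP s as_ sc cs; have := Slt s as_ sc.
  have : e * (s - a) <= e * (c - a) by rewrite ler_pM2l //; lra.
  by lra.
have Sc : S c.
  split; first by rewrite ac cb.
  move=> u au; rewrite le_eqVlt => /orP[/eqP->//|]; exact: Slt.
have [cE|ncb] := eqVneq c b; first by move: phic; rewrite cE; lra.
have cLb : c < b by rewrite lt_neqAle ncb.
have [d d0 dP] := rd c ac cLb e e0.
pose s := Num.min b (c + d / 2).
have cs : c < s by rewrite lt_min cLb /=; lra.
have sb : s <= b by rewrite ge_min lexx.
have sd : s <= c + d / 2 by rewrite ge_min lexx orbT.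
suff Ss : S s by have := ub_le_sup hS.2 Ss; rewrite -/c; lra.
split; first by rewrite sb (le_trans ac) // ltW.
move=> u au us; have [uc|cu] := leP u c; first exact: Sc.2.
have := dP u cu (le_trans us sb) ltac:(lra).
have -> : e * (u - a) = e * (u - c) + e * (c - a) by ring.
by lra.
Qed.

(** * Arbitrary norms on column vectors *)

Section Norm.
Variables (n : nat) (nu : 'cV[R]_n -> R).
Hypothesis nuP : is_norm nu.

Lemma nu_ge0 x : 0 <= nu x. Proof. by case: nuP. Qed.
Lemma nu_eq0 x : nu x = 0 -> x = 0. Proof. by case: nuP => _ H _ _; exact: H. Qed.
Lemma nuZ a x : nu (a *: x) = `|a| * nu x. Proof. by case: nuP. Qed.
Lemma nuD x y : nu (x + y) <= nu x + nu y. Proof. by case: nuP. Qed.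
Lemma nu0 : nu 0 = 0. Proof. by rewrite -(scale0r 0) nuZ normr0 mul0r. Qed.
Lemma nuN x : nu (- x) = nu x.
Proof. by rewrite -scaleN1r nuZ normrN1 mul1r. Qed.
Lemma nuB x y : nu (x - y) <= nu x + nu y.
Proof. by rewrite -(nuN y) nuD. Qed.
Lemma nu_dist x y : nu (x - y) = nu (y - x). Proof. by rewrite -nuN opprB. Qed.
Lemma nu_tri x y z : nu (x - z) <= nu (x - y) + nu (y - z).
Proof. by apply: le_trans (nuD _ _); rewrite addrA subrK. Qed.
Lemma nu_lip x y : nu x <= nu y + nu (x - y).
Proof. by apply: le_trans (nuD _ _); rewrite addrC subrK. Qed.

Lemma nu_sum (I : Type) (r : seq I) (Q : pred I) (F : I -> 'cV[R]_n) :
  nu (\sum_(i <- r | Q i) F i) <= \sum_(i <- r | Q i) nu (F i).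
Proof.
elim/big_rec2: _ => [|i x y _ IH]; first by rewrite nu0.
by apply: le_trans (nuD _ _) _; rewrite lerD2l.
Qed.

Lemma nu_le_norm : exists2 c, 0 < c & forall x, nu x <= c * `|x|.
Proof.
exists (1 + \sum_(i < n) nu (delta_mx i 0)).
  by rewrite ltr_pwDl // sumr_ge0 // => i _; exact: nu_ge0.
move=> x; rewrite {1}(matrix_sum_delta x).
apply: le_trans (nu_sum _ _ _) _; rewrite mulrDl mul1r mulr_suml.
rewrite -[leLHS]add0r; apply: lerD => //; apply: ler_sum => i _.
by rewrite big_ord1 nuZ mulrC ler_wpM2l ?nu_ge0 // mx_entry_le.
Qed.

(** Otherwise there are unit vectors with [nu] tending to [0]; their ultralimit has [nu] equal to
    [0], hence is [0], which no limit of unit vectors can be. *)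
Lemma norm_le_nu : exists2 c, 0 < c & forall x, `|x| <= c * nu x.
Proof.
have [c c0 cP] := nu_le_norm.
apply: contrapT => H.
have bad (k : nat) : exists x, `|x| = 1 /\ nu x < k.+1%:R^-1.
  apply: contrapT => nx; apply: H; exists k.+1%:R => // x.
  have [->|x0] := eqVneq x 0; first by rewrite normr0 mulr_ge0 // nu_ge0.
  have nx0 : 0 < `|x| by rewrite normr_gt0.
  rewrite leNgt; apply/negP => lt; apply: nx; exists (`|x|^-1 *: x).
  rewrite normrZ nuZ normfV normr_id mulVf ?gt_eqF //; split=> //.
  by rewrite -ltr_pdivlMl ?invr_gt0 // invrK -[ltRHS]mulrC ltr_pdivlMl.
have [x xP] := choice bad.
have [U [UU Uinf]] := ultra_eventually.
have [|l lP] := @ultra_lim_mx R U UU _ _ x 1; first by move=> k; rewrite (xP k).1.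
have nl : nu l = 0.
  apply/eqP; rewrite eq_le nu_ge0 andbT; apply/ler_addgt0Pr => e e0; rewrite add0r.
  have e1 : 0 < e / 2 / c by rewrite !divr_gt0.
  have [k [/= kl ke]] := filter_ex (filterI (lP _ e1) (Uinf (Num.truncn (e / 2)^-1))).
  have h2 : k.+1%:R^-1 < e / 2.
    rewrite invf_plt ?posrE ?divr_gt0 //; apply: lt_le_trans (truncnS_gt _) _.
    by rewrite ler_nat.
  have := nu_lip l (x k); have := cP (l - x k); rewrite distrC.
  have : c * `|x k - l| <= e / 2 by rewrite mulrC -ler_pdivlMr // ltW.
  by have := lt_trans (xP k).2 h2; lra.
have [k /=] := filter_ex (lP 1 ltr01).
by rewrite (nu_eq0 nl) subr0 (xP k).1 ltxx.
Qed.

(** Only left continuity and right derivatives are asked of [W], because the functions it will be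
    applied to have kinks at the grid nodes. *)
Lemma mean_value_ineq (W dW : R -> 'cV[R]_n) (g : 'cV[R]_n) (a b c : R) : a <= b ->
  (forall t, a < t -> t <= b -> forall e, 0 < e -> exists2 d, 0 < d &
    forall s, a <= s -> s < t -> t - s < d -> nu (W t - W s) <= e) ->
  (forall t, a <= t -> t < b -> forall e, 0 < e -> exists2 d, 0 < d &
    forall s, t < s -> s <= b -> s - t < d ->
      nu (W s - W t - (s - t) *: dW t) <= e * (s - t)) ->
  (forall t, a <= t -> t < b -> nu (dW t - g) <= c) ->
  nu (W b - W a - (b - a) *: g) <= c * (b - a).
Proof.
move=> ab lc rd bd.
(* [phi] vanishes at [a], and by subadditivity of [nu] its right Dini derivative is at most
   [nu (dW t - g) - c <= 0]. *)
pose phi t := nu (W t - W a - (t - a) *: g) - c * (t - a).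
suff : phi b <= phi a by rewrite /phi !subrr scale0r subr0 nu0 mulr0 subr0 subr_le0.
have step s t : nu (W s - W a - (s - a) *: g) - nu (W t - W a - (t - a) *: g)
    <= nu (W s - W t - (s - t) *: g).
  rewrite lerBlDl; apply: le_trans (nu_lip _ (W t - W a - (t - a) *: g)) _.
  rewrite lerD2l le_eqVlt; apply/orP; left; apply/eqP; congr nu.
  by apply/colP => i; rewrite !mxE; ring.
apply: right_dini_le => // t.
  move=> at_ tb e e0.
  have [d d0 dP] := lc t at_ tb (e / 2) ltac:(lra).
  pose q := nu g + `|c| + 1; have q0 : 0 < q by rewrite /q; have := nu_ge0 g; have := normr_ge0 c; lra.
  exists (Num.min d (e / 2 / q)); first by rewrite lt_min d0 !divr_gt0.
  move=> s as_ st; rewrite lt_min => /andP[std ste].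
  have h1 := dP s as_ st std; have h2 := step t s.
  have h3 := nuB (W t - W s) ((t - s) *: g).
  move: h3; rewrite nuZ gtr0_norm ?subr_gt0 // => h3.
  have h4 : (t - s) * q <= e / 2 by rewrite -ler_pdivlMr // ltW.
  have h5 : (t - s) * - c <= (t - s) * `|c|.
    by rewrite ler_pM2l ?subr_gt0 // -normrN ler_norm.
  move: h4; rewrite /q !mulrDr mulr1 => h4; rewrite /phi.
  have -> : c * (t - a) = c * (s - a) - (t - s) * - c by ring.
  by lra.
move=> at_ tb e e0; have [d d0 dP] := rd t at_ tb e e0; exists d => // s ts sb sd.
have h1 := dP s ts sb sd; have h2 := step s t; have h3 := bd t at_ tb.
have h4 : nu (W s - W t - (s - t) *: g) <=
    nu (W s - W t - (s - t) *: dW t) + (s - t) * nu (dW t - g).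
  rewrite -[X in X * nu _](@ger0_norm _ (s - t)); last by lra.
  by rewrite -nuZ scalerBr; exact: nu_tri.
have h5 : (s - t) * nu (dW t - g) <= (s - t) * c by rewrite ler_pM2l ?subr_gt0.
rewrite /phi; have -> : c * (s - a) = c * (t - a) + (s - t) * c by ring.
by lra.
Qed.

End Norm.
End Preliminaries.

(** * The Green function of an exponential dichotomy *)

Section NodeSums.
Variable R : realType.

(** A Riemann sum for the integral of [lam expR (lam s)] up to [t]. As [1 + lam d <= expR (lam d)],
    each term is at most the increment of the exponential to the next node, so the sum telescopes;
    the last node before [t] costs the factor [1 + lam d]. *)
Lemma exp_sum_left (lam d t : R) K : 0 < lam -> 0 < d -> 0 <= t ->
  \sum_(j < K | j%:R * d <= t) lam * d * expR (lam * (j%:R * d))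
    <= (1 + lam * d) * expR (lam * t).
Proof.
move=> l0 d0 t0; have ld : 0 < lam * d by rewrite mulr_gt0.
pose S k := \sum_(j < k | j%:R * d <= t) lam * d * expR (lam * (j%:R * d)).
have estep k : expR (lam * (k.+1%:R * d)) >= (1 + lam * d) * expR (lam * (k%:R * d)).
  have -> : lam * (k.+1%:R * d) = lam * d + lam * (k%:R * d) by rewrite -natr1; ring.
  by rewrite expRD ler_pM2r ?expR_gt0 // expR_ge1Dx.
suff : (K%:R * d <= t /\ S K <= expR (lam * (K%:R * d))) \/
       (t < K%:R * d /\ S K <= (1 + lam * d) * expR (lam * t)).
  case=> -[Kt]; last by [].
  move=> h; apply: le_trans h _; rewrite -[leLHS]mul1r ler_pM ?expR_ge0 //.
    by rewrite lerDl ltW.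
  by rewrite ler_expR ler_pM2l.
elim: K => [|K IH]; first by left; rewrite mul0r mulr0 expR0 /S big_ord0.
have KS : K%:R * d < K.+1%:R * d by rewrite ltr_pM2r // ltr_nat.
rewrite {1 2}/S big_mkcond big_ord_recr /= -big_mkcond -/(S K).
case: IH => -[Kt IH]; last first.
  by right; rewrite [K%:R * d <= t]leNgt Kt /= addr0; split=> //; exact: lt_trans KS.
have h : S K + lam * d * expR (lam * (K%:R * d)) <=
    (1 + lam * d) * expR (lam * (K%:R * d)) by rewrite mulrDl mul1r lerD2r.
rewrite Kt; have [Kt1|Kt1] := leP (K.+1%:R * d) t; [left|right]; split => //.
  exact: le_trans h (estep K).
apply: le_trans h _; rewrite ler_pM2l; last by lra.
by rewrite ler_expR ler_pM2l.
Qed.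

(** The induction carries the exponential at the last node next to the sum: it pays for both the
    next term and the next exponential. *)
Lemma exp_sum_right (lam d t : R) K : 0 < lam -> 0 < d ->
  \sum_(j < K | ~~ (j%:R * d <= t)) lam * d * expR (- lam * (j%:R * d))
    <= (1 + lam * d) * expR (- lam * t).
Proof.
move=> l0 d0; have ld : 0 < lam * d by rewrite mulr_gt0.
pose S k := \sum_(j < k | ~~ (j%:R * d <= t)) lam * d * expR (- lam * (j%:R * d)).
pose C := (1 + lam * d) * expR (- lam * t).
have C0 : 0 <= C by rewrite mulr_ge0 ?expR_ge0 //; lra.
have estep k : (1 + lam * d) * expR (- lam * (k.+1%:R * d)) <= expR (- lam * (k%:R * d)).
  have -> : - lam * (k%:R * d) = lam * d + - lam * (k.+1%:R * d) by rewrite -natr1; ring.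
  by rewrite expRD ler_pM2r ?expR_gt0 // expR_ge1Dx.
suff : S K = 0 \/ (0 < K)%N /\ S K + expR (- lam * (K.-1%:R * d)) <= C.
  rewrite -/(S K); case=> [-> //|[_]]; apply: le_trans.
  by rewrite lerDl expR_ge0.
elim: K => [|K IH]; first by left; rewrite /S big_ord0.
rewrite /S big_mkcond big_ord_recr /= -big_mkcond -/(S K).
have [Kt|Kt] /= := leP (K%:R * d) t; last first.
  right; split=> //; case: IH => [->|[K0 IH]].
    rewrite add0r -[X in _ + X]mul1r -mulrDl addrC.
    rewrite ler_pM2l ?ler_expR; last by lra.
    by rewrite !mulNr lerN2 ler_pM2l // ltW.
  apply: le_trans IH; rewrite -addrA lerD2l.
  by have := estep K.-1; rewrite prednK // mulrDl mul1r addrC.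
rewrite addr0; case: IH => [->|[K0 IH]]; [by left | right; split=> //].
apply: le_trans IH; rewrite lerD2l ler_expR !mulNr lerN2 ler_pM2l //.
by rewrite ler_pM2r // ler_nat leq_pred.
Qed.

Lemma node_count (d b : R) K : 0 < d -> 0 <= b -> b < K%:R * d ->
  b < \sum_(j < K) d *+ (j%:R * d <= b)%R <= b + d.
Proof.
move=> d0 b0 bK; pose S k := \sum_(j < k) d *+ (j%:R * d <= b)%R.
suff : (K%:R * d <= b + d /\ S K = K%:R * d) \/ (b < K%:R * d /\ b < S K <= b + d).
  by rewrite -/(S K); case=> [[le ->]|[_ //]]; rewrite bK le.
elim: K {bK} => [|K IH]; first by left; rewrite /S big_ord0 mul0r; split=> //; lra.
rewrite -natr1 mulrDl mul1r /S big_ord_recr /= -/(S K).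
case: IH => -[Kb IH]; last first.
  by right; rewrite [_ <= b]leNgt Kb mulr0n addr0; split=> //; lra.
rewrite IH; have [le|gt] := leP (K%:R * d) b; first by left; rewrite lerD2r.
by right; rewrite mulr0n addr0 gt Kb; split=> //; lra.
Qed.

(** Only the nodes in [(a, b]] carry weight, and by [node_count] their total weight differs from
    [b - a] by at most [d]. Replacing [F j] by [g] costs the first error term, correcting the weight
    the second. *)
Lemma node_increment n (nu : 'cV[R]_n -> R) (F : nat -> 'cV[R]_n) (g : 'cV[R]_n)
    (d a b c : R) K :
  is_norm nu -> 0 < d -> 0 <= a -> a <= b -> b < K%:R * d -> 0 <= c ->
  (forall j, (j < K)%N -> a <= j%:R * d -> j%:R * d <= b -> nu (F j - g) <= c) ->
  nu (\sum_(j < K) (d *+ (j%:R * d <= b)%R - d *+ (j%:R * d <= a)%R) *: F j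
      - (b - a) *: g) <= c * (b - a + d) + d * nu g.
Proof.
move=> nuP d0 a0 ab bK c0 Fg.
pose w (j : 'I_K) : R := d *+ (j%:R * d <= b)%R - d *+ (j%:R * d <= a)%R.
have w0 j : 0 <= w j.
  rewrite /w; have [ja|ja] := leP (j%:R * d) a; first by rewrite (le_trans ja ab) subrr.
  by rewrite subr0 mulrn_wge0 // ltW.
have wE : \sum_j w j = \sum_(j < K) d *+ (j%:R * d <= b)%R - \sum_(j < K) d *+ (j%:R * d <= a)%R.
  by rewrite /w sumrB.
have /andP[b1 b2] := node_count d0 (le_trans a0 ab) bK.
have /andP[a1 a2] := node_count d0 a0 (le_lt_trans ab bK).
have -> : \sum_j w j *: F j - (b - a) *: g =
    \sum_j w j *: (F j - g) + (\sum_j w j - (b - a)) *: g.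
  rewrite [in RHS]scalerBl scaler_suml addrA; congr (_ - _); rewrite -big_split /=.
  by apply: eq_bigr => j _; rewrite scalerBr subrK.
apply: le_trans (nuD nuP _ _) _; apply: lerD; last first.
  rewrite (nuZ nuP) ler_wpM2r ?(nu_ge0 nuP) // ler_norml wE.
  by apply/andP; split; lra.
apply: le_trans (nu_sum nuP _ _ _) _.
apply: (@le_trans _ _ (\sum_j c * w j)); last first.
  by rewrite -mulr_sumr ler_wpM2l // wE; lra.
apply: ler_sum => j _; rewrite (nuZ nuP) ger0_norm // mulrC.
have [jb|jb] := leP (j%:R * d) b; last first.
  have ja : a < j%:R * d by exact: le_lt_trans jb.
  have -> : w j = 0 by rewrite /w [_ <= b]leNgt [_ <= a]leNgt jb ja subrr.
  by rewrite !mulr0.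
have [ja|ja] := leP (j%:R * d) a.
  have -> : w j = 0 by rewrite /w jb ja subrr.
  by rewrite !mulr0.
by rewrite ler_wpM2r // Fg // ltW.
Qed.

End NodeSums.

(** * Green sums, discrete solutions and their limit *)

Section Green.
Variables (R : realType) (n : nat) (nu : 'cV[R]_n -> R).
Variables (A : R -> 'M[R]_n) (T : R -> R -> 'M[R]_n) (P : R -> 'M[R]_n) (N lam : R).
Hypothesis nuP : is_norm nu.
Hypothesis TP : transition_matrix A T.
Hypotheses (N0 : 0 < N) (lam0 : 0 < lam).
Hypothesis dich1 : forall t s, 0 <= s -> s <= t ->
  mxnorm_le nu (T t s *m P s) (N * expR (- lam * (t - s))).
Hypothesis dich2 : forall t s, 0 <= t -> t <= s ->
  mxnorm_le nu (T t s *m (1%:M - P s)) (N * expR (- lam * (s - t))).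

Definition green t s := if s <= t then T t s *m P s else T t s *m (P s - 1%:M).

Lemma transition_deriv s p t : 0 <= s -> 0 <= t -> forall e, 0 < e ->
  exists2 d, 0 < d & forall t', 0 <= t' -> `|t' - t| < d ->
    nu (T t' s *m p - T t s *m p - (t' - t) *: (A t *m (T t s *m p))) <= e * `|t' - t|.
Proof.
move=> s0 t0 e e0; have [_ /has_deriv_on_epsP/(_ t t0) H] := TP s0.
have [c c0 cP] := nu_le_norm nuP.
pose q := c * n%:R * `|p| + 1; have q0 : 0 < q.
  by rewrite ltr_wpDl // !mulr_ge0 // ltW.
have [d d0 dP] := H (e / q) (divr_gt0 e0 q0); exists d => // t' t'0 tt'.
have := dP t' t'0 tt'; set M := T t' s - _ - _ => MP.
have -> : T t' s *m p - T t s *m p - (t' - t) *: (A t *m (T t s *m p)) = M *m p.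
  by rewrite /M !mulmxBl -scalemxAl mulmxA.
apply: le_trans (cP _) _.
apply: (@le_trans _ _ (c * (n%:R * `|M| * `|p|))).
  by rewrite ler_pM2l // mulmx_norm_le.
have -> : c * (n%:R * `|M| * `|p|) = (q - 1) * `|M| by rewrite /q; ring.
apply: (@le_trans _ _ (q * `|M|)); first by rewrite ler_wpM2r //; lra.
by rewrite mulrC -ler_pdivlMr // mulrAC.
Qed.

Lemma transition_cont s p t : 0 <= s -> 0 <= t -> forall e, 0 < e ->
  exists2 d, 0 < d & forall t', 0 <= t' -> `|t' - t| < d ->
    nu (T t' s *m p - T t s *m p) <= e.
Proof.
move=> s0 t0 e e0; have [d d0 dP] := transition_deriv p s0 t0 ltr01.
set w := A t *m _ in dP; have q0 : 0 < 1 + nu w by rewrite ltr_pwDl // nu_ge0.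
exists (Num.min d (e / (1 + nu w))); first by rewrite lt_min d0 divr_gt0.
move=> t' t'0; rewrite lt_min => /andP[td te].
apply: le_trans (nu_lip nuP _ ((t' - t) *: w)) _; rewrite (nuZ nuP) addrC.
apply: le_trans (lerD (dP t' t'0 td) (lexx _)) _.
by rewrite mul1r -[X in X + _]mulr1 -mulrDr -ler_pdivlMr // ltW.
Qed.

(* The jump of the Green function at [t = s] is the identity, so this is continuous in [t]. *)
Definition cgreen s (v : 'cV[R]_n) t := green t s *m v - (s <= t)%R%:R *: v.

(** To the right of [t] the branch of [green] does not change: [s <= t] persists, and for [t < s]
    the radius is kept below [s - t]. *)
Lemma cgreen_right_deriv s v t : 0 <= s -> 0 <= t -> forall e, 0 < e ->
  exists2 d, 0 < d & forall t', t < t' -> t' - t < d ->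
    nu (cgreen s v t' - cgreen s v t - (t' - t) *: (A t *m (green t s *m v)))
      <= e * (t' - t).
Proof.
move=> s0 t0 e e0; rewrite /cgreen /green.
have [st|ts] := leP s t.
  have [d d0 dP] := transition_deriv (P s *m v) s0 t0 e0; exists d => // t' tt' t'd.
  have tt0 : `|t' - t| = t' - t by rewrite gtr0_norm ?subr_gt0.
  rewrite (le_trans st (ltW tt')) opprB addrA subrK -!mulmxA -[X in e * X]tt0.
  by apply: dP; [lra | rewrite tt0].
have [d d0 dP] := transition_deriv ((P s - 1%:M) *m v) s0 t0 e0.
exists (Num.min d (s - t)); first by rewrite lt_min d0 subr_gt0.
move=> t' tt'; rewrite lt_min => /andP[t'd t's].
have -> : (s <= t') = false by apply/negbTE; rewrite -ltNge; lra.
have tt0 : `|t' - t| = t' - t by rewrite gtr0_norm ?subr_gt0.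
rewrite !scale0r !subr0 -!mulmxA -[X in e * X]tt0.
by apply: dP; [lra | rewrite tt0].
Qed.

Lemma cgreen_left_cont s v t : 0 <= s -> 0 < t -> forall e, 0 < e ->
  exists2 d, 0 < d & forall t', 0 <= t' -> t' < t -> t - t' < d ->
    nu (cgreen s v t - cgreen s v t') <= e.
Proof.
move=> s0 t0 e e0; rewrite /cgreen /green.
have [st|ts] := ltP s t.
  have [d d0 dP] := transition_cont (P s *m v) s0 (ltW t0) e0.
  exists (Num.min d (t - s)); first by rewrite lt_min d0 subr_gt0.
  move=> t' t'0 tt'; rewrite lt_min => /andP[t'd t's].
  rewrite (ltW st) (_ : s <= t'); last by lra.
  rewrite opprB addrA subrK -!mulmxA (nu_dist nuP).
  by apply: dP; rewrite // ltr0_norm; lra.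
have [d d0 dP] := transition_cont ((P s - 1%:M) *m v) s0 (ltW t0) e0.
exists d => // t' t'0 tt' t'd.
have -> : (s <= t') = false by apply/negbTE; rewrite -ltNge; lra.
(* At [t = s] the subtracted indicator term turns [P s] into [P s - 1], so the formula from the left
   also gives the value at [t]. *)
have -> : (if s <= t then T t s *m P s else T t s *m (P s - 1%:M)) *m v - (s <= t)%R%:R *: v
    = T t s *m ((P s - 1%:M) *m v).
  have [st|_] := leP s t; last by rewrite scale0r subr0 mulmxA.
  have -> : t = s by apply/eqP; rewrite eq_le ts st.
  by rewrite (TP s0).1 !mul1mx scale1r mulmxBl mul1mx.
rewrite scale0r subr0 -!mulmxA (nu_dist nuP).
by apply: dP; rewrite // ltr0_norm; lra.
Qed.

Lemma green_le t s v : 0 <= t -> 0 <= s ->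
  nu (green t s *m v) <=
    N * (if s <= t then expR (- lam * (t - s)) else expR (- lam * (s - t))) * nu v.
Proof.
move=> t0 s0; rewrite /green; case: (leP s t) => st.
  have h := dich1 s0 st; exact: h.
by rewrite -opprB mulmxN mulNmx (nuN nuP); have h := dich2 t0 (ltW st); exact: h.
Qed.

(** The nodes up to [t] and those after [t] contribute at most [N B / lam (1 + lam d)] each, by the
    two exponential sums, whatever the number of nodes. *)
Lemma green_sum_le (F : nat -> 'cV[R]_n) (B d t : R) K : 0 < d -> 0 <= t -> 0 <= B ->
  (forall j, (j < K)%N -> nu (F j) <= B) ->
  nu (\sum_(j < K) d *: (green t (j%:R * d) *m F j)) <= 2 * N * B / lam * (1 + lam * d).
Proof.
move=> d0 t0 B0 FB; apply: le_trans (nu_sum nuP _ _ _) _.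
rewrite (bigID (fun j : 'I_K => j%:R * d <= t)) /=.
have NBl : 0 <= N * B / lam by rewrite divr_ge0 ?mulr_ge0 // ltW.
have -> : 2 * N * B / lam * (1 + lam * d) =
    N * B / lam * (1 + lam * d) + N * B / lam * (1 + lam * d).
  by rewrite -mulrDl; congr (_ * _); rewrite -!mulrA mulr2n mulrDl mul1r.
have jd0 (j : 'I_K) : 0 <= j%:R * d by rewrite mulr_ge0 // ltW.
have lamK x : lam^-1 * (lam * x) = x by rewrite mulrA mulVf ?mul1r // gt_eqF.
apply: lerD.
  have := exp_sum_left K lam0 d0 t0.
  move=> /(ler_wpM2r (expR_ge0 (- lam * t))).
  rewrite -(mulrA (1 + lam * d)) -expRD mulNr subrr expR0 mulr1 => /(ler_wpM2l NBl).
  apply: le_trans; rewrite mulr_suml mulr_sumr; apply: ler_sum => j jt.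
  have := green_le (F j) t0 (jd0 j); rewrite jt => h.
  rewrite (nuZ nuP) gtr0_norm // -(mulrA (lam * d)) -expRD.
  have -> : lam * (j%:R * d) + - (lam * t) = - lam * (t - j%:R * d) by ring.
  set E := expR _ in h *; have E0 : 0 <= E by exact: expR_ge0.
  have -> : N * B / lam * (lam * d * E) = d * (N * E * B).
    by rewrite -!mulrA lamK; ring.
  rewrite ler_pM2l //; apply: le_trans h _.
  by rewrite ler_wpM2l ?FB // mulr_ge0 // ltW.
have := exp_sum_right t K lam0 d0.
move=> /(ler_wpM2r (expR_ge0 (lam * t))).
rewrite -(mulrA (1 + lam * d)) -expRD mulNr addNr expR0 mulr1 => /(ler_wpM2l NBl).
apply: le_trans; rewrite mulr_suml mulr_sumr; apply: ler_sum => j jt.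
have := green_le (F j) t0 (jd0 j); rewrite (negbTE jt) => h.
rewrite (nuZ nuP) gtr0_norm // -(mulrA (lam * d)) -expRD.
have -> : - lam * (j%:R * d) + lam * t = - lam * (j%:R * d - t) by ring.
set E := expR _ in h *; have E0 : 0 <= E by exact: expR_ge0.
have -> : N * B / lam * (lam * d * E) = d * (N * E * B).
  by rewrite -!mulrA lamK; ring.
rewrite ler_pM2l //; apply: le_trans h _.
by rewrite ler_wpM2l ?FB // mulr_ge0 // ltW.
Qed.

Definition green_sum K d (F : nat -> 'cV[R]_n) t :=
  \sum_(j < K) d *: (green t (j%:R * d) *m F j).

(** The sum of the [cgreen] terms is continuous from the left with right derivative [A] times the
    Green sum, so [mean_value_ineq] applies to it; the jumps removed from it are handled by
    [node_increment]. *)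
Lemma green_sum_increment K d (F : nat -> 'cV[R]_n) (g1 g2 : 'cV[R]_n) a b c1 c2 :
  0 < d -> 0 <= a -> a <= b -> b < K%:R * d -> 0 <= c2 ->
  (forall t, a <= t -> t <= b -> nu (A t *m green_sum K d F t - g1) <= c1) ->
  (forall j, (j < K)%N -> a <= j%:R * d -> j%:R * d <= b -> nu (F j - g2) <= c2) ->
  nu (green_sum K d F b - green_sum K d F a - (b - a) *: (g1 + g2)) <=
    c1 * (b - a) + c2 * (b - a + d) + d * nu g2.
Proof.
move=> d0 a0 ab bK c20 H1 H2.
have jd0 (j : 'I_K) : 0 <= j%:R * d by rewrite mulr_ge0 // ltW.
pose W t := \sum_(j < K) d *: cgreen (j%:R * d) (F j) t.
have WE : green_sum K d F b - green_sum K d F a - (b - a) *: (g1 + g2) =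
    (W b - W a - (b - a) *: g1) +
    (\sum_(j < K) (d *+ (j%:R * d <= b)%R - d *+ (j%:R * d <= a)%R) *: F j - (b - a) *: g2).
  have WEt t : W t = green_sum K d F t - \sum_(j < K) (d *+ (j%:R * d <= t)%R) *: F j.
    rewrite /W /green_sum -sumrB; apply: eq_bigr => j _.
    by rewrite /cgreen scalerBr scalerA mulr_natr.
  rewrite !WEt (eq_bigr _ (fun j _ => scalerBl _ _ _)) sumrB.
  by apply/colP => i; rewrite !mxE; ring.
rewrite WE; apply: le_trans (nuD nuP _ _) _; rewrite -(addrA (c1 * (b - a))); apply: lerD; last first.
  exact: (node_increment nuP d0 a0 ab bK c20 H2).
(* The tolerance is shared among [K] nodes of weight [d]; the added [1] keeps the divisor positive
   for [K = 0]. *)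
pose e' e : R := e / (K%:R * d + 1).
have Kd0 : 0 < K%:R * d + 1 by rewrite ltr_wpDl // mulr_ge0 // ltW.
have e'0 e : 0 < e -> 0 < e' e by move=> ?; rewrite divr_gt0.
have e'P e : 0 < e -> \sum_(j < K) d * e' e <= e.
  move=> e0; rewrite sumr_const card_ord -[_ *+ K]mulr_natl /e' !mulrA ler_pdivrMr //.
  by rewrite mulrC ler_pM2l //; lra.
apply: (mean_value_ineq nuP (dW := fun t => A t *m green_sum K d F t)) => //.
- move=> t at_ tb e e0.
  have [r r0 rP] := @fin_min R 'I_K (fun j r => forall t', 0 <= t' -> t' < t -> t - t' < r ->
      nu (cgreen (j%:R * d) (F j) t - cgreen (j%:R * d) (F j) t') <= e' e)
    (fun j => let: ex_intro2 r r0 rP := cgreen_left_cont (F j) (jd0 j)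
      (le_lt_trans a0 at_) (e'0 e e0) in
      ex_intro2 _ _ r r0 (fun r' rr' t' h1 h2 h3 => rP t' h1 h2 (lt_le_trans h3 rr'))).
  exists r => // s as_ st sr; rewrite /W -sumrB.
  apply: le_trans (nu_sum nuP _ _ _) _; apply: le_trans (e'P e e0).
  apply: ler_sum => j _; rewrite -scalerBr (nuZ nuP) gtr0_norm // ler_pM2l //.
  by apply: rP => //; lra.
- move=> t at_ tb e e0; have t0 : 0 <= t by lra.
  have [r r0 rP] := @fin_min R 'I_K (fun j r => forall t', t < t' -> t' - t < r ->
      nu (cgreen (j%:R * d) (F j) t' - cgreen (j%:R * d) (F j) t
        - (t' - t) *: (A t *m (green t (j%:R * d) *m F j))) <= e' e * (t' - t))
    (fun j => let: ex_intro2 r r0 rP := cgreen_right_deriv (F j) (jd0 j) t0 (e'0 e e0) in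
      ex_intro2 _ _ r r0 (fun r' rr' t' h1 h2 => rP t' h1 (lt_le_trans h2 rr'))).
  exists r => // s ts sb sr; rewrite /W /green_sum -sumrB mulmx_sumr scaler_sumr -sumrB.
  apply: le_trans (nu_sum nuP _ _ _) _.
  apply: (@le_trans _ _ ((\sum_(j < K) d * e' e) * (s - t))); last first.
    by rewrite ler_pM2r ?subr_gt0 // e'P.
  rewrite mulr_suml; apply: ler_sum => j _.
  rewrite -scalerBr -scalemxAr scalerA (mulrC (s - t) d) -(scalerA d) -scalerBr (nuZ nuP) gtr0_norm //.
  by rewrite -mulrA ler_pM2l // rP.
- by move=> t at_ tb; apply: H1 => //; exact: ltW.
Qed.

(** The unknown is a matrix whose columns are the values at the nodes. By [green_sum_le] the map [H]
    has bounded range, so Brouwer's theorem applies. *)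
Lemma discrete_solution (Phi : R -> 'cV[R]_n -> 'cV[R]_n) (B d : R) K :
  0 < d -> 0 <= B -> (forall t x, nu (Phi t x) <= B) ->
  (forall t, eps_continuous (Phi t)) ->
  exists F : nat -> 'cV[R]_n, forall j, (j < K)%N ->
    F j = Phi (j%:R * d) (green_sum K d F (j%:R * d)).
Proof.
move=> d0 B0 PhiB Phic.
have [c1 c10 c1P] := nu_le_norm nuP; have [c2 c20 c2P] := norm_le_nu nuP.
have jd0 (j : nat) : 0 <= j%:R * d by rewrite mulr_ge0 // ltW.
pose F (Z : 'M[R]_(n, K)) (j : nat) : 'cV[R]_n :=
  oapp (fun i : 'I_K => Phi (j%:R * d) (col i Z)) 0 (insub j).
have FE Z (j : 'I_K) : F Z j = Phi (j%:R * d) (col j Z) by rewrite /F valK.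
pose H (Z : 'M[R]_(n, K)) : 'M[R]_(n, K) :=
  \matrix_(i, j) (green_sum K d (F Z) (j%:R * d)) i 0.
have FB Z j : (j < K)%N -> nu (F Z j) <= B by move=> jK; rewrite (FE Z (Ordinal jK)).
pose q b := 2 * N * b / lam * (1 + lam * d).
have ld : 0 < 1 + lam * d by rewrite addr_gt0 // mulr_gt0.
have q0 b : 0 <= b -> 0 <= q b.
  by move=> b0; rewrite mulr_ge0 ?divr_ge0 ?mulr_ge0 // ltW.
have HB Z : `|H Z| <= c2 * q B.
  apply: mx_norm_le => [|i j]; first by rewrite mulr_ge0 ?q0 // ltW.
  rewrite mxE; apply: le_trans (mx_entry_le _ i 0) _.
  apply: le_trans (c2P _) _; rewrite ler_pM2l //.
  by apply: green_sum_le => //; exact: FB.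
have Hc : eps_continuous H.
  move=> Z e e0; pose p := c2 * q c1.
  have p0 : 0 < p + 1 by rewrite ltr_wpDl // mulr_ge0 ?q0 // ltW.
  pose e1 := e / (p + 1); have e10 : 0 < e1 by rewrite divr_gt0.
  have [r r0 rP] := @fin_min R 'I_K (fun j r => forall x, `|x - col j Z| < r ->
      `|Phi (j%:R * d) x - Phi (j%:R * d) (col j Z)| < e1)
    (fun j => let: ex_intro2 r r0 rP := Phic (j%:R * d) (col j Z) e1 e10 in
      ex_intro2 _ _ r r0 (fun r' rr' x h => rP x (lt_le_trans h rr'))).
  exists r => // Z' Z'Z.
  have colP j : `|col j Z' - col j Z| < r.
    apply: le_lt_trans Z'Z; apply: mx_norm_le => // i i'.
    have -> : (col j Z' - col j Z) i i' = (Z' - Z) i j by rewrite !mxE.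
    exact: mx_entry_le.
  apply: (@le_lt_trans _ _ (c2 * q (c1 * e1))).
    have qe : 0 <= q (c1 * e1) by apply: q0; rewrite ltW // mulr_gt0.
    apply: mx_norm_le => [|i j]; first by rewrite mulr_ge0 // ltW.
    (* The Green sum is linear in [F], so [green_sum_le] with bound [c1 * e1] also yields
       continuity. *)
    have -> : (H Z' - H Z) i j =
        (green_sum K d (fun j => F Z' j - F Z j) (j%:R * d)) i 0.
      rewrite !mxE !summxE -sumrB; apply: eq_bigr => j' _.
      by rewrite mulmxBr scalerBr !mxE.
    apply: le_trans (mx_entry_le _ i 0) _.
    apply: le_trans (c2P _) _; rewrite ler_pM2l //.
    apply: green_sum_le => //; first by rewrite ltW // mulr_gt0.
    move=> j' j'K; rewrite (FE Z (Ordinal j'K)) (FE Z' (Ordinal j'K)).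
    apply: le_trans (c1P _) _; rewrite ler_pM2l // ltW //.
    exact: (rP (Ordinal j'K)).
  have -> : c2 * q (c1 * e1) = p * e1 by rewrite /p /q; ring.
  by rewrite /e1 mulrA ltr_pdivrMr // mulrC ltr_pM2l // ltrDl.
have [Z ZE] := brouwer_mx Hc HB.
exists (F Z) => j jK; rewrite {1}(_ : j = Ordinal jK :> nat) // FE.
congr Phi; rewrite -[in LHS]ZE; apply/colP => i; by rewrite !mxE.
Qed.

Hypothesis Ac : {within [set t | 0 <= t], continuous A}.

Lemma approximate_solutions (Phi : R -> 'cV[R]_n -> 'cV[R]_n) (B : R) :
  0 <= B -> (forall t x, nu (Phi t x) <= B) -> (forall t, eps_continuous (Phi t)) ->
  exists z : nat -> R -> 'cV[R]_n, forall k d, d = k.+1%:R^-1 ->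
    (forall t, 0 <= t -> nu (z k t) <= 2 * N * B / lam * (1 + lam * d)) /\
    (forall a b g1 g2 c1 c2, 0 <= a -> a <= b -> b < k.+1%:R -> 0 <= c2 ->
      (forall t, a <= t -> t <= b -> nu (A t *m z k t - g1) <= c1) ->
      (forall t, a <= t -> t <= b -> nu (Phi t (z k t) - g2) <= c2) ->
      nu (z k b - z k a - (b - a) *: (g1 + g2)) <=
        c1 * (b - a) + c2 * (b - a + d) + d * nu g2).
Proof.
move=> B0 PhiB Phic.
(* This many nodes of mesh [1 / k.+1] reach up to time [k.+1], so the mesh shrinks while the horizon
   grows. *)
pose d k : R := k.+1%:R^-1; pose K k := (k.+1 * k.+1)%N.
have d0 k : 0 < d k by rewrite invr_gt0.
have [F FP] := choice (fun k => @discrete_solution Phi B (d k) (K k) (d0 k) B0 PhiB Phic).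
exists (fun k => green_sum (K k) (d k) (F k)) => k _ ->; rewrite -/(d k).
have FB j : (j < K k)%N -> nu (F k j) <= B by move=> jK; rewrite FP.
split=> [t t0|a b g1 g2 c1 c2 a0 ab bk c20 H1 H2]; first exact: green_sum_le.
have Kd : (K k)%:R * d k = k.+1%:R by rewrite natrM mulfK.
apply: green_sum_increment => //; first by rewrite Kd.
by move=> j jK aj jb; rewrite FP //; exact: H2.
Qed.

Lemma mulmx_joint_cont (x0 : 'cV[R]_n) t : 0 <= t -> forall e, 0 < e ->
  exists2 d, 0 < d & forall s x, 0 <= s -> `|s - t| < d -> `|x - x0| < d ->
    nu (A s *m x - A t *m x0) <= e.
Proof.
move=> t0 e e0; have /within_continuous_epsP/(_ t t0) H := Ac.
have [c c0 cP] := nu_le_norm nuP.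
pose q := c * n%:R * (`|x0| + 1 + `|A t|) + 1.
have q0 : 0 < q by rewrite ltr_wpDl // !mulr_ge0 ?addr_ge0 // ltW.
pose e1 := e / q; have e10 : 0 < e1 by rewrite divr_gt0.
have [d d0 dP] := H e1 e10.
exists (Num.min d (Num.min 1 e1)); first by rewrite !lt_min d0 ltr01.
move=> s x s0; rewrite !lt_min => /and3P[st _ _] /and3P[_ x1 xe].
have -> : A s *m x - A t *m x0 = (A s - A t) *m x + A t *m (x - x0).
  by rewrite mulmxBl mulmxBr addrA subrK.
apply: le_trans (cP _) _.
have xb : `|x| <= `|x0| + 1.
  by have := ler_normD (x - x0) x0; rewrite subrK; lra.
have h1 : `|(A s - A t) *m x| <= n%:R * e1 * (`|x0| + 1).
  apply: le_trans (mulmx_norm_le _ _) _; apply: ler_pM => //; rewrite ?mulr_ge0 //.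
  by rewrite ler_wpM2l // ltW // dP.
have h2 : `|A t *m (x - x0)| <= n%:R * `|A t| * e1.
  apply: le_trans (mulmx_norm_le _ _) _; apply: ler_wpM2l; last exact: ltW.
  by rewrite mulr_ge0.
apply: (@le_trans _ _ (c * (n%:R * e1 * (`|x0| + 1) + n%:R * `|A t| * e1))).
  by rewrite ler_pM2l //; apply: le_trans (ler_normD _ _) _; exact: lerD.
have -> : c * (n%:R * e1 * (`|x0| + 1) + n%:R * `|A t| * e1) = e1 * (q - 1).
  by rewrite /q; ring.
apply: (@le_trans _ _ (e1 * q)); first by rewrite ler_pM2l //; lra.
by rewrite /e1 divfK // gt_eqF.
Qed.

Lemma local_bound t : 0 <= t -> exists C d, [/\ 0 < C, 0 < d &
  forall s x, 0 <= s -> `|s - t| < d -> nu (A s *m x) <= C * nu x].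
Proof.
move=> t0; have /within_continuous_epsP/(_ t t0 1 ltr01)[d d0 dP] := Ac.
have [c1 c10 c1P] := nu_le_norm nuP; have [c2 c20 c2P] := norm_le_nu nuP.
pose a := n%:R * (`|A t| + 1) : R.
have a0 : 0 <= a by rewrite mulr_ge0 ?addr_ge0.
exists (c1 * (a * c2) + 1), d; split=> //.
  by rewrite ltr_wpDl // !mulr_ge0 // ltW.
move=> s x s0 st; have As : `|A s| <= `|A t| + 1.
  by have := dP s s0 st; have := ler_normD (A s - A t) (A t); rewrite subrK; lra.
apply: le_trans (c1P _) _; rewrite mulrDl mul1r -[leLHS]addr0; apply: lerD; last exact: nu_ge0.
rewrite -mulrA ler_pM2l //; apply: le_trans (mulmx_norm_le _ _) _.
rewrite -mulrA -mulrA mulrA; apply: ler_pM; rewrite ?mulr_ge0 //.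
by rewrite ler_wpM2l.
Qed.

Theorem bounded_solution (D : set R) (Phi : R -> 'cV[R]_n -> 'cV[R]_n) (B : R) :
  0 <= B -> (forall t, D t -> 0 <= t) ->
  (forall s t, 0 <= s -> s <= t -> D t -> D s) ->
  (forall t x, D t -> nu (Phi t x) <= B) ->
  (forall t x e, D t -> 0 < e -> exists2 d, 0 < d &
    forall s y, D s -> `|s - t| < d -> `|y - x| < d -> `|Phi s y - Phi t x| < e) ->
  exists z : R -> 'cV[R]_n,
    has_deriv_on D z (fun t => A t *m z t + Phi t (z t)) /\
    forall t, D t -> nu (z t) <= 2 * N * B / lam.
Proof.
move=> B0 Dge0 Dint PhiB Phic.
have [c1 c10 c1P] := nu_le_norm nuP; have [c2 c20 c2P] := norm_le_nu nuP.
(* The grids may run past the end of [D], so [Phi] is extended by [0]; the discrete problem only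
   needs continuity in [x]. *)
pose Psi t x := if `[< D t >] then Phi t x else 0.
have PsiE t x : D t -> Psi t x = Phi t x by move=> Dt; rewrite /Psi asboolT.
have PsiB t x : nu (Psi t x) <= B.
  by rewrite /Psi; case: asboolP => Dt; [exact: PhiB | rewrite nu0].
have Psic t : eps_continuous (Psi t).
  rewrite /Psi => x e e0; case: asboolP => Dt; last first.
    by exists 1 => // y _; rewrite subrr normr0.
  have [d d0 dP] := Phic t x e Dt e0; exists d => // y xy.
  by apply: dP => //; rewrite subrr normr0.
have [z zP] := approximate_solutions B0 PsiB Psic.
have [h hE] : exists h : nat -> R, forall k, h k = k.+1%:R^-1 by eexists.
have h0 k : 0 < h k by rewrite hE invr_gt0.
have h1 k : h k <= 1 by rewrite hE invf_le1 // ler1n.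
have zB k := (zP k (h k) (hE k)).1; have zI k := (zP k (h k) (hE k)).2.
have [U [UU Uinf]] := ultra_eventually.
have Uh (e : R) : 0 < e -> U [set k | h k < e].
  move=> e0; apply: filterS (Uinf (Num.truncn e^-1)) => k /= ek; rewrite hE.
  by rewrite invf_plt ?posrE //; apply: lt_le_trans (truncnS_gt _) _; rewrite ler_nat.
have Ub (b : R) : U [set k | b < k.+1%:R].
  apply: filterS (Uinf (Num.truncn b)) => k /= bk.
  by apply: lt_le_trans (truncnS_gt _) _; rewrite ler_nat.
pose q := 2 * N * B / lam; have q0 : 0 <= q by rewrite divr_ge0 ?mulr_ge0 // ltW.
pose Q := q * (1 + lam); have Q0 : 0 <= Q by rewrite mulr_ge0 // addr_ge0 // ltW.
have zQ k t : 0 <= t -> nu (z k t) <= Q.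
  move=> t0; apply: le_trans (zB k t t0) _; rewrite ler_wpM2l // lerD2l.
  by rewrite -[leRHS]mulr1 ler_pM2l.
have lim t : exists l : 'cV[R]_n, 0 <= t -> forall e, 0 < e -> U [set k | nu (z k t - l) < e].
  have [t0|t0] := leP 0 t; last by exists 0.
  have [|l lP] := @ultra_lim_mx R U UU _ _ (fun k => z k t) (c2 * Q).
    by move=> k; apply: le_trans (c2P _) _; rewrite ler_pM2l // zQ.
  exists l => _ e e0; apply: filterS (lP (e / c1) (divr_gt0 e0 c10)) => k /= kl.
  by apply: le_lt_trans (c1P _) _; rewrite mulrC -ltr_pdivlMr.
have [zeta zetaP] := choice lim.
exists zeta; split; last first.
  move=> t /Dge0 t0; rewrite -/q; apply/ler_addgt0Pr => e e0.
  (* The bound on [z k] exceeds [q] by [q * lam * h k], which this makes at most [e / 2]. *)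
  pose e1 := e / 2 / (q * lam + 1).
  have ql : 0 < q * lam + 1 by rewrite ltr_wpDl // mulr_ge0 // ltW.
  have e10 : 0 < e1 by rewrite !divr_gt0.
  have e20 : 0 < e / 2 by lra.
  have [k [/= kz kh]] := filter_ex (filterI (zetaP t t0 _ e20) (Uh _ e10)).
  have := nu_lip nuP (zeta t) (z k t); rewrite (nu_dist nuP) => l1.
  have := zB k t t0; rewrite -/q mulrDr mulr1 mulrA => l2.
  have l3 : q * lam * h k <= (q * lam + 1) * h k by rewrite ler_pM2r //; lra.
  have l4 : (q * lam + 1) * h k <= e / 2 by rewrite mulrC -ler_pdivlMr // ltW.
  by lra.
apply/has_deriv_on_epsP => t Dt e e0; have t0 := Dge0 t Dt.
pose g1 := A t *m zeta t; pose g2 := Phi t (zeta t).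
have [C [dC [C0 dC0 CP]]] := local_bound t0.
(* The linear part and [Phi] each contribute [eps]; [c2] converts [nu] back to the matrix norm. *)
pose eps := e / c2 / 2; have eps0 : 0 < eps by rewrite !divr_gt0.
have [d1 d10 d1P] := mulmx_joint_cont (zeta t) t0 eps0.
have [d2 d20 d2P] := Phic t (zeta t) (eps / c1) Dt (divr_gt0 eps0 c10).
pose r := Num.min d1 d2; have r0 : 0 < r by rewrite lt_min d10.
(* Within [d] of [t] each relevant [z k] stays within [r] of [zeta t]: a third of [r] is spent on
   the distance at [t], one on the drift [L * d] and one on the mesh error [L * h k]. *)
pose L := c2 * (C * Q + B + 1).
have CQ0 : 0 <= C * Q by rewrite mulr_ge0 // ltW.
have L0 : 0 < L by rewrite mulr_gt0 // ltr_wpDl // addr_ge0.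
pose d := Num.min dC (Num.min r (r / 3 / L)).
have d0 : 0 < d by rewrite !lt_min dC0 d10 d20 !divr_gt0.
have dP : d <= dC /\ d <= d1 /\ d <= d2 /\ L * d <= r / 3.
  have dle : d <= r / 3 / L by rewrite !ge_min lexx !orbT.
  split; first by rewrite !ge_min lexx.
  split; first by rewrite !ge_min lexx !orbT.
  split; first by rewrite !ge_min lexx !orbT.
  by rewrite mulrC -ler_pdivlMr.
have {dP} [ddC [dd1 [dd2 Ld]]] := dP.
(* An ordered pair near [t] serves both one-sided difference quotients. *)
suff key a b : a <= b -> D a -> D b -> `|a - t| < d -> `|b - t| < d ->
    nu (zeta b - zeta a - (b - a) *: (g1 + g2)) <= (e / c2) * (b - a).
  exists d => // s Ds st; apply: le_trans (c2P _) _.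
  rewrite -ler_pdivlMl // mulrA [c2^-1 * e]mulrC.
  have tt : `|t - t| < d by rewrite subrr normr0.
  have [ts|st'] := leP t s.
    by rewrite ger0_norm ?subr_ge0 //; exact: key.
  rewrite ltr0_norm ?subr_lt0 // opprB -(nuN nuP).
  have -> : - (zeta s - zeta t - (s - t) *: (g1 + g2)) =
      zeta t - zeta s - (t - s) *: (g1 + g2) by apply/colP => i; rewrite !mxE; ring.
  by apply: key => //; exact: ltW.
move=> ab Da Db at_ bt; apply/ler_addgt0Pr => e3 e30.
have a0 := Dge0 a Da; have b0 := Dge0 b Db.
have near s : a <= s -> s <= b -> [/\ D s, 0 <= s & `|s - t| < d].
  move=> as_ sb; have s0 : 0 <= s by lra.
  split=> //; first exact: (Dint s b).
  by move: at_ bt; rewrite !ltr_norml => /andP[? ?] /andP[? ?]; apply/andP; split; lra.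
(* The thirds cover the limits at [b] and at [a] and the mesh terms [h k * (eps + nu g2)]. *)
pose e4 := e3 / 3; have e40 : 0 < e4 by rewrite /e4; lra.
pose e5 := e4 / (eps + nu g2 + 1).
have en0 : 0 < eps + nu g2 + 1 by have := nu_ge0 nuP g2; lra.
have e50 : 0 < e5 by rewrite divr_gt0.
have r30 : 0 < r / 3 by lra.
have [k /= [[kb kh] [[kt ka] [kB kT]]]] := filter_ex (filterI
  (filterI (zetaP b b0 _ e40) (Uh _ (divr_gt0 r30 L0)))
  (filterI (filterI (zetaP t t0 _ (divr_gt0 r30 c20)) (zetaP a a0 _ e40))
    (filterI (Uh _ e50) (filterI (Ub b) (Ub t))))).
have {kT} [kT1 kT2] := kT.
have close s : a <= s -> s <= b -> `|z k s - zeta t| < r.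
  move=> as_ sb; have [Ds s0 st] := near s as_ sb.
  (* With [g1 = g2 = 0] the increment estimate is a Lipschitz bound up to a mesh error. *)
  have lip u v : 0 <= u -> u <= v -> v < k.+1%:R -> `|u - t| < d -> `|v - t| < d ->
      nu (z k v - z k u) <= C * Q * (v - u) + B * (v - u + h k).
    move=> u0 uv vk ut vt.
    have := zI k u v 0 0 (C * Q) B u0 uv vk B0.
    rewrite addr0 scaler0 subr0 (nu0 nuP) mulr0 addr0; apply.
      move=> w uw wv; rewrite subr0; apply: le_trans (CP w _ _ _) _; [lra| |].
        by move: ut vt; rewrite !ltr_norml => /andP[? ?] /andP[? ?]; apply/andP; split; lra.
      by rewrite ler_pM2l // zQ //; lra.
    by move=> w _ _; rewrite subr0.
  have tt : `|t - t| < d by rewrite subrr normr0.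
  have lipst : nu (z k s - z k t) <= C * Q * d + B * (d + h k).
    have mono u v : u <= v -> v - u < d -> C * Q * (v - u) + B * (v - u + h k) <=
        C * Q * d + B * (d + h k).
      by move=> uv vd; apply: lerD; apply: ler_wpM2l => //; rewrite ?lerD2r ltW.
    have [ts|lst] := leP t s.
      apply: le_trans (lip t s t0 ts _ tt st) (mono _ _ ts _).
        exact: le_lt_trans sb kT1.
      by rewrite -[ltLHS]ger0_norm ?subr_ge0.
    rewrite (nu_dist nuP); apply: le_trans (lip s t s0 (ltW lst) kT2 st tt) (mono _ _ (ltW lst) _).
    by rewrite -[ltLHS]opprB -ltr0_norm ?subr_lt0.
  have n1 := nu_tri nuP (z k s) (z k t) (zeta t).
  apply: le_lt_trans (c2P _) _.
  have n2 : c2 * nu (z k t - zeta t) < r / 3 by rewrite mulrC -ltr_pdivlMr.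
  have n3 : L * h k < r / 3 by rewrite mulrC -ltr_pdivlMr.
  have n4 : c2 * (C * Q * d + B * (d + h k)) <= L * d + L * h k.
    have -> : L * d + L * h k = c2 * (C * Q * d + B * (d + h k))
        + (c2 * d + c2 * (C * Q + 1) * h k) by rewrite /L; ring.
    by rewrite lerDl addr_ge0 ?mulr_ge0 ?addr_ge0 // ltW.
  have n5 : c2 * nu (z k s - zeta t) <=
      c2 * (C * Q * d + B * (d + h k)) + c2 * nu (z k t - zeta t).
    by rewrite -mulrDr ler_pM2l //; lra.
  by lra.
have main := zI k a b g1 g2 eps eps a0 ab kT1 (ltW eps0).
have {}main : nu (z k b - z k a - (b - a) *: (g1 + g2)) <=
    eps * (b - a) + eps * (b - a + h k) + h k * nu g2.
  apply: main => s as_ sb; have [Ds s0 st] := near s as_ sb.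
    apply: d1P => //; first exact: lt_le_trans st dd1.
    by apply: lt_le_trans (close s as_ sb) _; rewrite ge_min lexx.
  rewrite PsiE //; apply: le_trans (c1P _) _; rewrite mulrC -ler_pdivlMr // ltW //.
  apply: d2P => //; first exact: lt_le_trans st dd2.
  by apply: lt_le_trans (close s as_ sb) _; rewrite ge_min lexx orbT.
have tri : nu (zeta b - zeta a - (b - a) *: (g1 + g2)) <=
    nu (z k b - z k a - (b - a) *: (g1 + g2)) + (nu (z k a - zeta a) + nu (z k b - zeta b)).
  apply: le_trans (nu_lip nuP _ (z k b - z k a - (b - a) *: (g1 + g2))) _.
  rewrite lerD2l; apply: le_trans (nuB nuP _ _).
  by rewrite le_eqVlt; apply/orP; left; apply/eqP; congr nu; apply/colP => i; rewrite !mxE; ring.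
have small : h k * (eps + nu g2 + 1) <= e4 by rewrite -ler_pdivlMr // ltW.
have -> : e / c2 = eps + eps by rewrite /eps; field; rewrite gt_eqF.
have e4E : e3 = e4 + e4 + e4 by rewrite /e4; field.
have := h0 k; move: small main; rewrite !(mulrDl, mulrDr) mulr1.
by move: (nu_ge0 nuP g2) => ? ? ? ?; lra.
Qed.

End Green.

(** * Pseudosolutions in a ball *)

(** Changing the vector and changing the scaling factor cost at most [nu (x - y)] each, since
    [Num.max rho (nu x)] is 1-Lipschitz in [x] and bounds [nu x]. *)
Lemma retraction_lip (R : realType) n (nu : 'cV[R]_n -> R) (rho : R) (x y : 'cV[R]_n) :
  is_norm nu -> 0 < rho ->
  nu ((rho / Num.max rho (nu x)) *: x - (rho / Num.max rho (nu y)) *: y) <=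
    2 * nu (x - y).
Proof.
move=> nuP rho0; set m := Num.max rho (nu x); set m' := Num.max rho (nu y).
have rm : rho <= m by rewrite le_max lexx.
have rm' : rho <= m' by rewrite le_max lexx.
have m0 : 0 < m by lra.
have m'0 : 0 < m' by lra.
have ym' : nu y <= m' by rewrite le_max lexx orbT.
have md : `|m' - m| <= nu (x - y).
  have h1 := nu_lip nuP x y; have h2 := nu_lip nuP y x; rewrite (nu_dist nuP) in h2.
  have h0 := nu_ge0 nuP (x - y).
  rewrite ler_norml /m /m' /Num.max; apply/andP.
  by do 2!case: ifPn; rewrite -?leNgt => ? ?; split; lra.
have -> : (rho / m) *: x - (rho / m') *: y =
    (rho / m) *: (x - y) + ((rho / m) * ((m' - m) / m')) *: y.
  have -> : (rho / m) * ((m' - m) / m') = rho / m - rho / m'.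
    by field; rewrite !gt_eqF.
  by rewrite scalerBr scalerBl addrA subrK.
have rm10 : 0 <= rho / m by rewrite divr_ge0 // ltW.
have rm11 : rho / m <= 1 by rewrite ler_pdivrMr // mul1r.
apply: le_trans (nuD nuP _ _) _; rewrite mulr_natl mulr2n; apply: lerD.
  by rewrite (nuZ nuP) ger0_norm // ler_piMl // nu_ge0.
rewrite (nuZ nuP) normrM (ger0_norm rm10) -mulrA.
apply: le_trans (ler_piMl _ rm11) _; first by rewrite mulr_ge0 // nu_ge0.
rewrite normrM normfV (gtr0_norm m'0) -mulrA.
apply: le_trans md; apply: ler_piMr => //.
by rewrite mulrC ler_pdivrMr // mul1r.
Qed.

Lemma retraction_eps_continuous (R : realType) n (nu : 'cV[R]_n -> R) (rho : R) :
  is_norm nu -> 0 < rho ->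
  eps_continuous (fun x => (rho / Num.max rho (nu x)) *: x).
Proof.
move=> nuP rho0 x e e0.
have [c1 c10 c1P] := nu_le_norm nuP; have [c2 c20 c2P] := norm_le_nu nuP.
exists (e / (2 * c2 * c1)); first by rewrite !divr_gt0 // !mulr_gt0.
move=> y; rewrite ltr_pdivlMr ?mulr_gt0 // => yx.
apply: le_lt_trans (c2P _) _.
have h1 := retraction_lip y x nuP rho0; have h2 := c1P (y - x).
apply: le_lt_trans yx.
have -> : `|y - x| * (2 * c2 * c1) = c2 * (2 * (c1 * `|y - x|)) by ring.
by rewrite ler_pM2l //; lra.
Qed.

Theorem mainTheorem4 (R : realType) (n : nat) (nu : 'cV[R]_n -> R)
  (rho : R) (A : R -> 'M[R]_n) (f : R -> 'cV[R]_n -> 'cV[R]_n)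
  (T : R -> R -> 'M[R]_n) (N lam L : R) :
  is_norm nu ->
  0 < rho ->
  {within [set t | 0 <= t], continuous A} ->
  {within [set p : R * 'cV[R]_n | 0 <= p.1], continuous (fun p => f p.1 p.2)} ->
  transition_matrix A T ->
  0 < N -> 0 < lam ->
  exp_dichotomy nu T N lam ->
  0 < L ->
  (forall t x, 0 <= t -> nu x <= rho -> nu (f t x) <= L * nu x) ->
  L < lam / (2 * N) ->
  exists eps : R, 0 < eps /\
    forall (tau : \bar R) (y dy : R -> 'cV[R]_n),
      (0 < tau)%E ->
      pseudosolution nu (fun t x => A t *m x + f t x) tau y dy ->
      (forall t, dom0 tau t -> err nu (fun t x => A t *m x + f t x) y dy t <= eps) ->
      exists z dz : R -> 'cV[R]_n,
        pseudosolution nu (fun t x => A t *m x + f t x) tau z dz /\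
        (forall t, dom0 tau t -> nu (z t) <= rho) /\
        (forall t, dom0 tau t ->
           err nu (fun t x => A t *m x + f t x) z dz t =
           err nu (fun t x => A t *m x + f t x) y dy t).
Proof.
move=> nuP rho0 Ac fc TP N0 lam0 [P [_ [_ [dich1 dich2]]]] L0 fL Llam.
(* Chosen so that [2 * N * (L * rho + eps) / lam = rho]. *)
pose eps := rho * (lam / (2 * N) - L); have eps0 : 0 < eps by rewrite mulr_gt0 // subr_gt0.
exists eps; split=> // tau y dy _ [ydy dyc _] erry.
set D := dom0 tau.
have D0 t : D t -> 0 <= t by case.
have Dint s t : 0 <= s -> s <= t -> D t -> D s.
  by move=> s0 st [_ tt]; split=> //; apply: le_lt_trans tt; rewrite lee_fin.
have [c1 c10 c1P] := nu_le_norm nuP; have [c2 c20 c2P] := norm_le_nu nuP.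
pose g t x := A t *m x + f t x.
pose h t := dy t - g t (y t).
pose r (x : 'cV[R]_n) := (rho / Num.max rho (nu x)) *: x.
have rle x : nu (r x) <= rho.
  rewrite /r (nuZ nuP); have m0 : 0 < Num.max rho (nu x) by rewrite lt_max rho0.
  have rm : 0 <= rho / Num.max rho (nu x) by rewrite divr_ge0 // ltW.
  rewrite (ger0_norm rm) -mulrA; apply: ler_piMr; first exact: ltW.
  by rewrite mulrC ler_pdivrMr // mul1r le_max lexx orbT.
have rid x : nu x <= rho -> r x = x.
  by move=> xr; rewrite /r max_l // divff ?scale1r // gt_eqF.
have rc : eps_continuous r by exact: retraction_eps_continuous.
have fjc t x e : 0 <= t -> 0 < e -> exists2 d, 0 < d & forall s x', 0 <= s ->
    `|s - t| < d -> `|x' - x| < d -> `|f s x' - f t x| < e.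
  move=> t0 e0; have /within_continuous_epsP/(_ (t, x) t0 e e0)[d d0 dP] := fc.
  exists d => // s x' s0 st xx'; apply: (dP (s, x')) => //.
  by rewrite prod_normE /= gt_max st xx'.
(* Used for [y] to make [h] continuous, and for [z] to make its derivative continuous. *)
have along (u : R -> 'cV[R]_n) t : D t -> (forall e, 0 < e -> exists2 d, 0 < d &
      forall s, D s -> `|s - t| < d -> `|u s - u t| < e) ->
    forall e, 0 < e -> exists2 d, 0 < d & forall s, D s -> `|s - t| < d ->
      `|g s (u s) - g t (u t)| < e.
  move=> Dt uc e e0; have e20 : 0 < e / 2 by lra.
  have e2c : 0 < e / 4 / c2 by rewrite !divr_gt0.
  have [d1 d10 d1P] := fjc t (u t) _ (D0 t Dt) e20.
  have [d2 d20 d2P] := mulmx_joint_cont nuP Ac (u t) (D0 t Dt) e2c.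
  have [d3 d30 d3P] := uc (Num.min d1 d2) ltac:(by rewrite lt_min d10).
  exists (Num.min d3 (Num.min d1 d2)); first by rewrite !lt_min d30 d10.
  move=> s Ds; rewrite !lt_min => /and3P[s3 s1 s2].
  have := d3P s Ds s3; rewrite lt_min => /andP[u1 u2].
  have h1 := d1P s (u s) (D0 s Ds) s1 u1.
  have h2 := d2P s (u s) (D0 s Ds) s2 u2.
  have h3 : `|A s *m u s - A t *m u t| <= e / 4.
    by apply: le_trans (c2P _) _; rewrite mulrC -ler_pdivlMr.
  have -> : g s (u s) - g t (u t) = (A s *m u s - A t *m u t) + (f s (u s) - f t (u t)).
    by rewrite /g opprD addrACA.
  by apply: le_lt_trans (ler_normD _ _) _; lra.
have deriv_cont (u du : R -> 'cV[R]_n) t : has_deriv_on D u du -> D t ->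
    forall e, 0 < e -> exists2 d, 0 < d &
      forall s, D s -> `|s - t| < d -> `|u s - u t| < e.
  move=> /has_deriv_on_epsP H Dt e e0; have [d d0 dP] := H t Dt 1 ltr01.
  have q0 : 0 < 1 + `|du t| by rewrite ltr_pwDl.
  exists (Num.min d (e / (1 + `|du t|))); first by rewrite lt_min d0 divr_gt0.
  move=> s Ds; rewrite lt_min => /andP[sd]; rewrite ltr_pdivlMr // => se.
  apply: le_lt_trans se; rewrite mulrDr mulr1 -normrZ.
  rewrite -lerBlDr; apply: le_trans (lerB_dist _ _) _.
  by have := dP s Ds sd; rewrite mul1r.
have hc t e : D t -> 0 < e -> exists2 d, 0 < d & forall s, D s -> `|s - t| < d ->
    `|h s - h t| < e.
  move=> Dt e0; have e20 : 0 < e / 2 by lra.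
  have /within_continuous_epsP/(_ t Dt _ e20)[d1 d10 d1P] := dyc.
  have [d2 d20 d2P] := along y t Dt (deriv_cont y dy t ydy Dt) _ e20.
  exists (Num.min d1 d2); first by rewrite lt_min d10.
  move=> s Ds; rewrite lt_min => /andP[s1 s2].
  have -> : h s - h t = (dy s - dy t) - (g s (y s) - g t (y t)).
    by rewrite /h; move: (g s _) (g t _) => ? ?; apply/colP => i; rewrite !mxE; ring.
  have := d1P s Ds s1; have := d2P s Ds s2; have := ler_normB (dy s - dy t) (g s (y s) - g t (y t)).
  by lra.
pose Phi t x := f t (r x) + h t.
have B0 : 0 <= L * rho + eps.
  by apply: addr_ge0; [apply: mulr_ge0|]; exact: ltW.
have [||z [zdz zb]] := @bounded_solution R n nu A T P N lam nuP TP N0 lam0 dich1 dich2 Ac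
    D Phi (L * rho + eps) B0 D0 Dint.
- move=> t x Dt; apply: le_trans (nuD nuP _ _) _; apply: lerD; last exact: erry.
  by apply: le_trans (fL _ _ (D0 t Dt) (rle x)) _; rewrite ler_pM2l.
- move=> t x e Dt e0; have e20 : 0 < e / 2 by lra.
  have [d1 d10 d1P] := fjc t (r x) _ (D0 t Dt) e20.
  have [d2 d20 d2P] := rc x d1 d10.
  have [d3 d30 d3P] := hc t _ Dt e20.
  exists (Num.min d1 (Num.min d2 d3)); first by rewrite !lt_min d10 d20.
  move=> s x' Ds; rewrite !lt_min => /and3P[s1 s2 s3] /and3P[x1 x2 x3].
  have h1 := d1P s (r x') (D0 s Ds) s1 (d2P x' x2).
  have h2 := d3P s Ds s3.
  by rewrite /Phi opprD addrACA; apply: le_lt_trans (ler_normD _ _) _; lra.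
have zrho t : D t -> nu (z t) <= rho.
  move=> Dt; apply: le_trans (zb t Dt) _; rewrite le_eqVlt; apply/orP; left; apply/eqP.
  by rewrite /eps; field; rewrite !gt_eqF.
(* Since [z] stays in the ball, [r] fixes its values, so [z] solves the original equation with
   forcing [h], the error vector of [y]. *)
pose dz t := g t (z t) + h t.
have zdz' : has_deriv_on D z dz.
  move=> t Dt; have -> : dz t = A t *m z t + Phi t (z t); last exact: zdz.
  by rewrite /dz /g /Phi rid ?addrA // zrho.
have errE t : err nu g z dz t = err nu g y dy t.
  by rewrite /err /dz addrC addKr.
exists z, dz; split; last by split.
split => //; last by exists eps => t Dt; rewrite -/(err nu g z dz t) errE; exact: erry.
apply/within_continuous_epsP => t Dt e e0; have e20 : 0 < e / 2 by lra.
have [d1 d10 d1P] := hc t _ Dt e20.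
have [d2 d20 d2P] := along z t Dt (deriv_cont z dz t zdz' Dt) _ e20.
exists (Num.min d1 d2); first by rewrite lt_min d10.
move=> s Ds; rewrite lt_min => /andP[s1 s2].
have h1 := d1P s Ds s1; have h2 := d2P s Ds s2.
by rewrite /dz opprD addrACA; apply: le_lt_trans (ler_normD _ _) _; lra.
Qed.
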